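(* There exist constants $c, C > 0$ such that for all integers $r \geq 2$, $$ c\, r^2 \ln r \;\leq\; s_r(K_3) \;\leq\; C\, r^2 (\ln r)^2 .$$
   Context: All graphs are finite and simple. For graphs $G,H$ and an integer $r\ge 1$, write $G \rightarrow (H)_r$ (''$G$ is $r$-Ramsey for $H$'') if every colouring of the edges of $G$ with $r$ colours contains a monochromatic copy of $H$. A graph $G$ is $r$-Ramsey-minimal for $H$ if $G \rightarrow (H)_r$ but no proper subgraph $G' \subsetneq G$ satisfies $G' \rightarrow (H)_r$. Let $\mathcal{M}_r(H)$ be the family of all graphs that are $r$-Ramsey-minimal for $H$, and define $s_r(H) := \min_{G \in \mathcal{M}_r(H)} \delta(G)$, where $\delta(G)$ is the minimum degree of $G$. $K_k$ denotes the complete graph on $k$ vertices. *)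

(* Defs.v *)
From mathcomp Require Import all_boot.
Set Implicit Arguments. Unset Strict Implicit. Unset Printing Implicit Defensive.

Definition simple_graph (V : finType) (E : rel V) : Prop :=
  symmetric E /\ irreflexive E.

(* r-colourings of the edges: a symmetric colour function on pairs
   (only its values on edges matter).  G -> (K_3)_r : every such colouring
   has a monochromatic triangle. *)
Definition ramsey_K3 (r : nat) (V : finType) (E : rel V) : Prop :=
  forall col : V -> V -> 'I_r, (forall x y, col x y = col y x) ->
    exists x y z : V,
      [&& E x y, E y z, E x z, col x y == col y z & col x y == col x z].

Definition sub_rel (V : finType) (A : {set V}) (F : rel V) : rel {x : V | x \in A} :=
  fun x y => F (val x) (val y).
Arguments sub_rel {V} A F.

Definition is_subgraph (V : finType) (E : rel V) (A : {set V}) (F : rel V) : Prop :=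
  symmetric F /\ (forall x y, F x y -> [&& E x y, x \in A & y \in A]).

Definition proper_subgraph (V : finType) (E : rel V) (A : {set V}) (F : rel V) : Prop :=
  is_subgraph E A F /\ (A != setT \/ exists x y, E x y && ~~ F x y).

Definition ramsey_minimal_K3 (r : nat) (V : finType) (E : rel V) : Prop :=
  simple_graph E /\ ramsey_K3 r E /\
  (forall (A : {set V}) (F : rel V), proper_subgraph E A F -> ~ ramsey_K3 r (sub_rel A F)).

Definition degree (V : finType) (E : rel V) (v : V) : nat := #|[set u | E v u]|.

Definition is_min_degree (V : finType) (E : rel V) (s : nat) : Prop :=
  (exists v, degree E v = s) /\ (forall v, s <= degree E v).

Definition is_s_r_K3 (r s : nat) : Prop :=
  (exists (V : finType) (E : rel V), ramsey_minimal_K3 r E /\ is_min_degree E s) /\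
  (forall (V : finType) (E : rel V), ramsey_minimal_K3 r E ->
     forall v : V, s <= degree E v).

(* Main.v *)
(** A colouring without monochromatic triangle of [G - v] that cannot be extended
    to [v] splits the neighbourhood of [v] into [r] edge-disjoint triangle-free
    graphs such that no map from the neighbourhood to the colours makes every class
    independent in the graph of its own colour.  The least number of vertices on
    which this can happen is [s_r(K_3)].

    Lower bound: with [k] colours left, the sparsest one on the [m] uncoloured
    vertices has average degree at most [m / k], so it has an independent set of
    order [k * ln (m / k)] (a uniformly random independent set is that large on
    average).  Giving this colour to that set and iterating colours every set of
    at most [c * r^2 * ln r] vertices.

    Upper bound: the local lemma packs [r] edge-disjoint triangle-free graphs with
    independence number below [n / r] into [n] vertices, [n] of order [r^2 * (ln r)^2].
    This pattern must then be forced, up to a permutation of the colours, in all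
    good colourings of some graph that is not Ramsey; adding one vertex joined to the
    pattern makes that graph Ramsey, and every minimal Ramsey subgraph contains the new
    vertex.  To force it, take a [K_4]-free Ramsey graph (partite construction, from
    Hales-Jewett), make it edge-minimal and delete an edge [xy]: then all colours occur
    on the edges from [x] to the common neighbours of [x] and [y], which are pairwise
    nonadjacent.  A maximal set [A] of these neighbours that can be monochromatic,
    together with one further neighbour [b], is a gadget saying "if the star on [A] is
    monochromatic then [b] has another colour".  Attached to all small subsets of
    large stars, it forces at every vertex [r] reference colours. *)
Require Import Defs.
From mathcomp Require Import all_boot all_order all_fingroup all_algebra zify.
From mathcomp Require ring lra.
From Stdlib Require Import Classical.
Set Implicit Arguments. Unset Strict Implicit. Unset Printing Implicit Defensive.

(** * Colourings without monochromatic triangles, and amalgamation *)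

Definition good_col r (V : finType) (E : rel V) (c : V -> V -> 'I_r) : Prop :=
  (forall x y, c x y = c y x) /\
  (forall x y z, E x y -> E y z -> E x z -> c x y = c y z -> c x y = c x z -> False).

Lemma not_ramseyE r (V : finType) (E : rel V) :
  ~ ramsey_K3 r E <-> exists c : V -> V -> 'I_r, good_col E c.
Proof.
split=> [nR | [c [cS cG]] R].
  apply: NNPP => nG; apply: nR => c cS; apply: NNPP => nT; apply: nG; exists c.
  split=> // x y z Exy Eyz Exz e1 e2; apply: nT; exists x, y, z.
  by rewrite Exy Eyz Exz e1 -e2 e1 eqxx.
have [x [y [z /and5P[Exy Eyz Exz /eqP e1 /eqP e2]]]] := R c cS.
exact: cG Exy Eyz Exz e1 e2.
Qed.

Lemma good_col_pull r (V W : finType) (E : rel V) (F : rel W) (h : V -> W) c :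
  (forall x y, E x y -> F (h x) (h y)) -> @good_col r W F c ->
  good_col E (fun x y => c (h x) (h y)).
Proof.
move=> hE [cS cG]; split=> [x y | x y z /hE Exy /hE Eyz /hE Exz]; first exact: cS.
exact: cG.
Qed.

Lemma good_col_perm r (V : finType) (E : rel V) (s : 'I_r -> 'I_r) c :
  injective s -> good_col E c -> good_col E (fun x y => s (c x y)).
Proof.
move=> sI [cS cG]; split=> [x y | x y z Exy Eyz Exz /sI e1 /sI e2]; first by rewrite cS.
exact: cG Exy Eyz Exz e1 e2.
Qed.

Section Glue.
Variables (B : finType) (EB : rel B) (V : finType) (E : rel V).
Variables (T : {pred V}) (P : pred {ffun V -> B}).
Hypotheses (EBS : symmetric EB) (ES : symmetric E).
Hypothesis PI : forall f, P f -> {in T &, injective f}.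
Hypothesis PE : forall f, P f -> {in T &, forall t t', EB (f t) (f t') = E t t'}.

(* One copy of [E] is glued to the base [EB] along each [f] satisfying [P].  Inside
   a copy the terminals [T] live in the base, so the vertices [inr (f, v)] with
   [v \in T] or [~~ P f] are isolated junk. *)
Definition glue : rel (B + {ffun V -> B} * V) := fun u v =>
  match u, v with
  | inl b, inl b' => EB b b'
  | inr (f, v), inr (g, w) => [&& P f, f == g, v \notin T, w \notin T & E v w]
  | inl b, inr (f, v) | inr (f, v), inl b =>
      [&& P f, v \notin T & [exists t in T, (f t == b) && E t v]]
  end.

Definition glue_map (f : {ffun V -> B}) (v : V) : B + {ffun V -> B} * V :=
  if v \in T then inl (f v) else inr (f, v).

Lemma glue_sym : symmetric glue.
Proof.
move=> [b|[f v]] [b'|[g w]] //=.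
have [->|_] := eqVneq f g; last by rewrite !andbF.
by rewrite ES; case: (P g) (v \in T) (w \in T) => -[] [].
Qed.

Lemma glue_irr : irreflexive EB -> irreflexive E -> irreflexive glue.
Proof. by move=> BI EI [b|[f v]] /=; rewrite ?BI ?EI ?andbF. Qed.

Lemma glue_mapE f v w : P f -> glue (glue_map f v) (glue_map f w) = E v w.
Proof.
move=> Pf; rewrite /glue_map.
have mix t u : t \in T -> u \notin T ->
    [exists t' in T, (f t' == f t) && E t' u] = E t u.
  move=> tT uT; apply/existsP/idP => [[t' /and3P[t'T /eqP e]]|Etu].
    by rewrite (PI Pf t'T tT e).
  by exists t; rewrite tT eqxx.
case: ifPn => vT; case: ifPn => wT /=.
- exact: PE.
- by rewrite Pf wT /= mix.
- by rewrite Pf vT /= mix // ES.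
- by rewrite Pf eqxx vT wT.
Qed.

Lemma glue_nbr f v u : glue (inr (f, v)) u ->
  [/\ P f, v \notin T & exists w, u = glue_map f w].
Proof.
case: u => [b|[g w]] /=.
  case/and3P=> Pf vT /existsP[t /and3P[tT /eqP <- Etv]]; split=> //; exists t.
  by rewrite /glue_map tT.
case/and5P=> Pf /eqP <- vT wT Evw; split=> //; exists w.
by rewrite /glue_map (negPf wT).
Qed.

(** All neighbours of an interior vertex of a copy lie in that copy, so a clique containing such a
    vertex does too. Triangles and [K_4]s of the amalgam therefore never mix two copies. The bound
    [1 < size s] excludes the isolated junk vertices. *)
Lemma glue_clique s : 1 < size s -> pairwise glue s ->
  (exists t, s = map inl t) \/
  (exists2 f, P f & exists t, s = map (glue_map f) t).
Proof.
move=> s1 cs; pose isl (u : B + {ffun V -> B} * V) := if u is inl _ then true else false.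
have [al|] := boolP (all isl s).
  left; elim: s al {s1 cs} => [|[b|//] s IHs] /=; first by exists [::].
  by case/IHs=> t ->; exists (b :: t).
case/allPn=> -[//|[f v]] xs _; right.
have nb u : u \in s -> u = inr (f, v) \/ glue (inr (f, v)) u.
  case/path.splitPr: xs cs => p1 p2; rewrite pairwise_cat /= allrel_consr.
  case/and3P=> /andP[/allP a1 _] _ /andP[/allP a2 _].
  rewrite mem_cat inE; case/or3P=> [/a1|/eqP ->|/a2]; [|by left|by right].
  by rewrite glue_sym; right.
have [Pf vT] : P f /\ v \notin T.
  case: s s1 cs xs nb => [//|x1 [//|x2 s]] _ /= /andP[/andP[e12 _] _] _ nb.
  have [e1|/glue_nbr[]//] := nb x1 (mem_head _ _).
  by move: e12; rewrite e1 => /glue_nbr[].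
exists f => //; have {}nb u : u \in s -> exists w, u = glue_map f w.
  move=> /nb [->|/glue_nbr[_ _ [w ->]]]; last by exists w.
  by exists v; rewrite /glue_map (negPf vT).
elim: s nb {s1 cs xs} => [|u s IHs] nb; first by exists [::].
have [w ->] := nb u (mem_head _ _).
have [u' us|t ->] := IHs; first by apply: nb; rewrite inE us orbT.
by exists (w :: t).
Qed.

Section Colour.
Variables (r : nat) (cB : B -> B -> 'I_r) (cV : {ffun V -> B} -> V -> V -> 'I_r).
Hypothesis cBG : good_col EB cB.
Hypothesis cVG : forall f, P f -> good_col E (cV f).
Hypothesis cVB : forall f, P f ->
  {in T &, forall t t', E t t' -> cV f t t' = cB (f t) (f t')}.

(** An edge from a terminal to an interior vertex takes its colour from the copy; [pick] recovers
    the terminal from its image. Where there is no edge, values of [cB] serve as symmetric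
    filler. *)
Definition glue_col (u v : B + {ffun V -> B} * V) : 'I_r :=
  match u, v with
  | inl b, inl b' => cB b b'
  | inr (f, v), inr (g, w) => if P f && (f == g) then cV f v w else cB (f v) (g w)
  | inl b, inr (f, v) | inr (f, v), inl b =>
      if P f then if [pick t in T | f t == b] is Some t then cV f t v else cB b b
      else cB b b
  end.

Lemma glue_col_map f v w : P f -> E v w ->
  glue_col (glue_map f v) (glue_map f w) = cV f v w.
Proof.
move=> Pf Evw; rewrite /glue_map; have cS := (cVG Pf).1.
have pickT u : u \in T -> [pick t in T | f t == f u] = Some u.
  move=> uT; case: pickP => [t /andP[tT /eqP e]|/(_ u)]; last by rewrite uT eqxx.
  by rewrite (PI Pf tT uT e).
case: ifPn => vT; case: ifPn => wT /=; rewrite ?Pf ?eqxx ?pickT //.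
by rewrite cVB.
Qed.

Lemma glue_col_good : good_col glue glue_col.
Proof.
split=> [[b|[f v]] [b'|[g w]] //=|x y z Exy Eyz Exz].
- by rewrite cBG.1.
- have [->|] := eqVneq f g; last by rewrite !andbF cBG.1.
  by rewrite !andbT cBG.1; case: ifP => // Pg; apply: (cVG Pg).1.
have : pairwise glue [:: x; y; z] by rewrite /= Exy Exz Eyz.
case/glue_clique=> // [[t]|[f Pf [t]]].
  case: t => [|a [|b [|c []]]] //= [? ? ?]; subst; exact: cBG.2.
case: t => [|a [|b [|c []]]] //= [? ? ?]; subst; move: Exy Eyz Exz.
rewrite !glue_mapE // => Eab Ebc Eac; rewrite !glue_col_map //.
exact: (cVG Pf).2.
Qed.
End Colour.
End Glue.

(** * The Hales-Jewett theorem *)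

Section HalesJewett.

Definition fill (A : Type) (a : A) (t : seq (option A)) : seq A := map (odflt a) t.

(** A combinatorial line over the letters below [k]: [None] marks the moving coordinates, of which
    there must be at least one. *)
Definition template k n (t : seq (option nat)) :=
  [&& size t == n, None \in t & all (fun o => if o is Some a then a < k else true) t].

Definition word k n (w : seq nat) := (size w == n) && all (fun a => a < k) w.

Lemma fill_word k n t a : a < k -> template k n t -> word k n (fill a t).
Proof.
move=> ak /and3P[/eqP <- _ /allP al]; rewrite /word size_map eqxx all_map /=.
by apply/allP => o /al; case: o.
Qed.

Lemma fill_cat (A : Type) (a : A) s t : fill a (s ++ t) = fill a s ++ fill a t.
Proof. exact: map_cat. Qed.

Lemma fill_Some (A : Type) (a : A) w : fill a (map Some w) = w.
Proof. by rewrite /fill -map_comp; apply: map_id. Qed.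

Lemma template_cat k n1 n2 s t : template k n1 s -> template k n2 t ->
  template k (n1 + n2) (s ++ t).
Proof.
case/and3P=> /eqP <- s0 sa /and3P[/eqP <- t0 ta].
by rewrite /template size_cat eqxx mem_cat s0 all_cat sa ta.
Qed.

Lemma template_catr k n1 n2 s w : template k n1 s -> word k n2 w ->
  template k (n1 + n2) (s ++ map Some w).
Proof.
case/and3P=> /eqP <- s0 sa /andP[/eqP <- wa].
by rewrite /template size_cat size_map eqxx mem_cat s0 all_cat sa all_map.
Qed.

Lemma template_catl k n1 n2 w t : word k n1 w -> template k n2 t ->
  template k (n1 + n2) (map Some w ++ t).
Proof.
case/andP=> /eqP <- wa /and3P[/eqP <- t0 ta].
by rewrite /template size_cat size_map eqxx mem_cat t0 orbT all_cat ta all_map wa.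
Qed.

Lemma templateS k n t : template k n t -> template k.+1 n t.
Proof.
case/and3P=> ? ? ta; apply/and3P; split=> //.
by apply: sub_all ta => -[a|//] /ltnW.
Qed.

Definition mono_template k (C : eqType) (c : seq nat -> C) t :=
  forall a, a < k -> c (fill a t) = c (fill 0 t).

Lemma hales_jewett_seq k (C : finType) : exists n, forall c : seq nat -> C,
  exists2 t, template k.+1 n t & mono_template k.+1 c t.
Proof.
elim: k C => [|k IHk] C.
  by exists 1 => c; exists [:: None] => // -[|a].
(* Colour focusing: [s] lines meeting in one last word [f], monochromatic in [s]
   distinct colours on the smaller alphabet. *)
have focus s : exists n, forall c : seq nat -> C,
    (exists2 t, template k.+2 n t & mono_template k.+2 c t) \/
    (exists2 f, word k.+2 n f & exists L, [/\ size L = s,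
       {in L, forall t, [/\ template k.+2 n t, fill k.+1 t = f & mono_template k.+1 c t]}
       & uniq [seq c (fill 0 t) | t <- L]]).
  elim: s => [|s [n IHs]].
    by exists 0 => c; right; exists [::] => //; exists [::].
  (* A word of length [n'] is coloured by the whole colouring it induces on its endings of length
     [n]. So one line [l] in the first block works for all endings at once, over the smaller
     alphabet. *)
  have [n' Hn'] := IHk {ffun n.-tuple 'I_k.+2 -> C}.
  exists (n' + n) => c.
  have [l lT lM] := Hn' (fun u => [ffun v : n.-tuple 'I_k.+2 => c (u ++ map val v)]).
  have {}lM a v : a < k.+1 -> word k.+2 n v -> c (fill a l ++ v) = c (fill 0 l ++ v).
    move=> ak /andP[sv /allP av].
    have sv' : size (map (inord : nat -> 'I_k.+2) v) == n by rewrite size_map.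
    have /ffunP/(_ (Tuple sv')) := lM a ak; rewrite !ffunE /= -map_comp.
    suff -> : map (val \o (inord : nat -> 'I_k.+2)) v = v by [].
    by rewrite -[RHS]map_id; apply/eq_in_map => x /av xk /=; rewrite inordK.
  have l0 : word k.+2 n' (fill 0 l) by apply: fill_word (templateS lT).
  have [[t tT tM]|[f fW [L [sL LP Lu]]]] := IHs (fun v => c (fill 0 l ++ v)).
    left; exists (map Some (fill 0 l) ++ t); first exact: template_catl.
    by move=> a ak; rewrite !fill_cat !fill_Some tM.
  (* If the focus has the colour of one of the lines, that line is monochromatic on the full
     alphabet. Otherwise moving [l] alone gives a line of a new colour, and the earlier lines are
     prolonged by [l]. *)
  have [fL|fL] := boolP (c (fill 0 l ++ f) \in [seq c (fill 0 l ++ fill 0 t) | t <- L]).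
    have [t tL e] := mapP fL; have [tT tf tM] := LP t tL.
    left; exists (map Some (fill 0 l) ++ t); first exact: template_catl.
    move=> a; rewrite ltnS leq_eqVlt => /orP[/eqP ->|ak].
      by rewrite !fill_cat !fill_Some tf e.
    by rewrite !fill_cat !fill_Some tM.
  right; exists (fill k.+1 l ++ f).
    have /andP[/eqP s1 a1] := fill_word (ltnSn k.+1) (templateS lT).
    have /andP[/eqP s2 a2] := fW.
    by rewrite /word size_cat s1 s2 eqxx all_cat a1 a2.
  exists ((l ++ map Some f) :: map (cat l) L); split.
  - by rewrite /= size_map sL.
  - move=> t; rewrite inE => /orP[/eqP ->|/mapP[t' /LP [tT tf tM] ->]]; split.
    + exact: template_catr (templateS lT) fW.
    + by rewrite fill_cat fill_Some.
    + by move=> a ak; rewrite !fill_cat !fill_Some lM.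
    + exact: template_cat (templateS lT) tT.
    + by rewrite fill_cat tf.
    + move=> a ak; rewrite !fill_cat lM ?tM //.
      exact: fill_word (leqW ak) tT.
  - rewrite /= -map_comp (eq_map (g := fun t => c (fill 0 l ++ fill 0 t))).
      by rewrite fill_cat fill_Some fL.
    by move=> t /=; rewrite fill_cat.
have [n Hn] := focus #|C|.+1; exists n => c.
have [//|[f _ [L [sL _ /card_uniqP]]]] := Hn c.
by rewrite size_map sL => e; have := max_card (mem [seq c (fill 0 t) | t <- L]); rewrite e ltnn.
Qed.

Lemma hales_jewett (A C : finType) : A -> exists n, forall c : {ffun 'I_n -> A} -> C,
  exists2 t : 'I_n -> option A, exists i, t i = None &
  exists k, forall a, c [ffun i => odflt a (t i)] = k.
Proof.
move=> a0; have Ak : #|A|.-1.+1 = #|A| by rewrite prednK //; apply/card_gt0P; exists a0.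
have [n Hn] := hales_jewett_seq #|A|.-1 C; exists n => c.
pose dec (m : nat) : A := nth a0 (enum A) m.
have [t /and3P[/eqP st t0 ta] tM] := Hn (fun w => c [ffun i : 'I_n => dec (nth 0 w i)]).
exists (fun i => omap dec (nth None t i)).
  by have [i it e] := nthP None t0; rewrite st in it; exists (Ordinal it); rewrite /= e.
exists (c [ffun i : 'I_n => dec (nth 0 (fill 0 t) i)]) => a.
have ak : index a (enum A) < #|A|.-1.+1 by rewrite Ak cardE index_mem mem_enum.
rewrite -(tM _ ak); congr c; apply/ffunP=> i; rewrite !ffunE (nth_map None) ?st //.
by case: (nth None t i) => //=; rewrite /dec nth_index // mem_enum.
Qed.
End HalesJewett.

(** * A K4-free Ramsey graph *)

Lemma pigeonhole (r m : nat) (X : finType) (S : {set X}) (f : X -> 'I_r) :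
  r * m < #|S| -> exists i, m < #|[set x in S | f x == i]|.
Proof.
move=> lt; apply/existsP/contraT => /existsPn no; rewrite -[false]/(~~ true) -lt -leqNgt.
rewrite -sum1_card (partition_big f predT) //= -[r in _ <= r * m]card_ord -sum_nat_const.
apply: leq_sum => i _; have := no i; rewrite -leqNgt -sum1_card; apply: leq_trans.
by rewrite (eq_bigl (mem [set x in S | f x == i])) // => x; rewrite /= inE.
Qed.

(** Induction on the number of colours still allowed inside [S]: in the majority neighbourhood [Q]
    of a vertex [v], either an edge of the majority colour closes a triangle or that colour no
    longer occurs. *)
Lemma ramsey_complete r : exists m, ramsey_K3 r (fun x y : 'I_m => x != y).
Proof.
suff claim : forall j, exists m, forall (V : finType) (c : V -> V -> 'I_r) (S : {set V}) (K : {set 'I_r}),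
    (forall x y, c x y = c y x) -> #|K| <= j ->
    {in S &, forall x y, x != y -> c x y \in K} -> m <= #|S| ->
    exists x y z, [&& x != y, y != z, x != z, c x y == c y z & c x y == c x z].
  have [m Hm] := claim r; exists m => c cS; apply: (Hm _ c setT setT) => //; rewrite ?cardsT ?card_ord //.
  by move=> x y _ _ _; rewrite inE.
elim=> [|j [m IHm]].
  exists 2 => V c S K cS; rewrite leqn0 cards_eq0 => /eqP -> SK /card_gt1P[x [y [xS yS]]].
  by move=> /(SK x y xS yS); rewrite inE.
exists (r * m).+2 => V c S K cS Kj SK Sm.
have /card_gt0P[v vS] : 0 < #|S| by apply: leq_trans Sm.
have [i] : exists i, m < #|[set x in S :\ v | c v x == i]|.
  by apply: pigeonhole; move: Sm; rewrite (cardsD1 v) vS.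
set Q := [set x in _ | _] => Qm.
have QP x : x \in Q -> [/\ x != v, x \in S & c v x = i].
  by rewrite !inE => /andP[/andP[? ?] /eqP].
have [[x [y /and4P[xQ yQ xy /eqP cxy]]]|no] :=
    classic (exists x y, [&& x \in Q, y \in Q, x != y & c x y == i]).
  have [[xv _ cx] [yv _ cy]] := (QP x xQ, QP y yQ).
  by exists v, x, y; rewrite eq_sym xv xy eq_sym yv cx cy cxy eqxx.
have iK : i \in K.
  have /card_gt0P[x /QP[xv xS <-]] : 0 < #|Q| by apply: leq_trans Qm.
  by apply: SK; rewrite // eq_sym.
apply: (IHm _ c Q (K :\ i)) => //; last exact: ltnW.
- by move: Kj; rewrite (cardsD1 i) iK.
- move=> x y xQ yQ xy; have [[_ xS _] [_ yS _]] := (QP x xQ, QP y yQ).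
  rewrite !inE SK // andbT; apply/negP => e; apply: no; exists x, y.
  by rewrite xQ yQ xy e.
Qed.

Definition K4free (V : finType) (E : rel V) := forall s, size s = 4 -> ~~ pairwise E s.

Section Partite.
Variables (r m : nat).

(* The base is the [N]-th power of the bipartite graph between parts [a] and [b];
   combinatorial lines of edges are induced copies of that graph, and a copy of [E]
   is glued along every induced copy. *)
Lemma partite_step (V : finType) (E : rel V) (p : V -> 'I_m) (a b : 'I_m) :
  0 < r -> a != b ->
  symmetric E -> (forall x y, E x y -> p x != p y) -> K4free E ->
  exists (V' : finType) (E' : rel V') (p' : V' -> 'I_m),
    [/\ symmetric E', forall x y, E' x y -> p' x != p' y, K4free E' &
     forall c : V' -> V' -> 'I_r, exists h : V -> V',
       [/\ forall x, p' (h x) = p x, forall x y, E x y -> E' (h x) (h y) &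
        exists k, forall x y, E x y -> p x = a -> p y = b -> c (h x) (h y) = k]].
Proof.
move=> r0 ab ES Ep K4.
pose isD (e : V * V) := [&& E e.1 e.2, p e.1 == a & p e.2 == b].
have [e0 De0|noD] := pickP isD; last first.
  exists V, E, p; split=> // c; exists id; split=> //; exists (Ordinal r0) => x y Exy px py.
  by have := noD (x, y); rewrite /isD /= Exy px py !eqxx.
pose D : finType := {e | isD e}; pose d0 : D := Sub e0 De0.
have [N HJ] := @hales_jewett D 'I_r d0.
pose B := (bool * {ffun 'I_N -> V})%type.
pose EB (u v : B) := (u.1 != v.1) &&
  [forall i, if u.1 then isD (v.2 i, u.2 i) else isD (u.2 i, v.2 i)].
have EBS : symmetric EB.
  move=> [[] g] [[] h] //.
pose T : {pred V} := [pred v | (p v == a) || (p v == b)].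
pose P (f : {ffun V -> B}) := [&& [forall t in T, (f t).1 == (p t == b)],
  [forall t in T, forall t' in T, (f t == f t') ==> (t == t')] &
  [forall t in T, forall t' in T, EB (f t) (f t') == E t t']].
have PI f : P f -> {in T &, injective f}.
  case/and3P=> _ /forall_inP I _ t t' tT t'T e.
  by have /forall_inP/(_ t' t'T) := I t tT; rewrite e eqxx => /eqP.
have PE f : P f -> {in T &, forall t t', EB (f t) (f t') = E t t'}.
  case/and3P=> _ _ /forall_inP I t t' tT t'T.
  by have /forall_inP/(_ t' t'T)/eqP := I t tT.
have Pside f t : P f -> t \in T -> (f t).1 = (p t == b).
  by case/and3P=> /forall_inP I _ _ /I/eqP.
pose p' (u : B + {ffun V -> B} * V) := match u with
  | inl (s, _) => if s then b else a | inr (_, v) => p v end.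
have p'map f v : P f -> p' (glue_map T f v) = p v.
  move=> Pf; rewrite /glue_map; case: ifP => //= vT; have := Pside f v Pf vT.
  case: (f v) => s g /= ->; case: eqP => [->//|]; move: vT; rewrite inE.
  by case/orP=> /eqP.
pose G := glue EB E T P.
have cl s : 1 < size s -> pairwise G s -> _ := @glue_clique _ _ _ _ T P EBS ES s.
have gm : forall f v w, P f -> G _ _ = E v w := @glue_mapE _ _ _ _ T P ES PI PE.
exists (B + {ffun V -> B} * V)%type, G, p'; split.
- exact: glue_sym.
- move=> x y Exy; have pw : pairwise G [:: x; y] by rewrite /= Exy.
  have [[t]|[f Pf [t]]] := cl [:: x; y] isT pw.
  + case: t => [|u [|v []]] //= [? ?]; subst; move: Exy => /= /andP[].
    by case: u v {pw} => [[] g] [[] h] //= _ _; rewrite 1?eq_sym.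
  + case: t => [|u [|v []]] //= [? ?]; subst; rewrite !p'map //.
    by move: Exy; rewrite gm //; apply: Ep.
- move=> s s4; apply/negP => cs.
  have [|[t e]|[f Pf [t e]]] := cl s _ cs; first by rewrite s4.
  + move: s4 cs; rewrite e size_map pairwise_map.
    case: t {e} => [|u [|v [|w t]]] //= _ /and3P[/and3P[uv uw _] /andP[vw _] _].
    move: uv uw vw => /= /andP[+ _] /andP[+ _] /andP[+ _].
    by case: u.1 v.1 w.1 => [] [] [].
  + move: s4 cs; rewrite e size_map pairwise_map => t4 ct; apply/negP: (K4 t t4); rewrite negbK.
    by apply: sub_pairwise ct => x y; rewrite /relpre /= gm.
- move=> c.
  (* A word of edges is read as one edge of the power, with its end [sq w false] in part [a] and its
     end [sq w true] in part [b]. *)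
  pose sq (w : {ffun 'I_N -> D}) s : B + {ffun V -> B} * V :=
    inl (s, [ffun i => let e := val (w i) in if s then e.2 else e.1]).
  have [t [i0 ti0] [k ck]] := HJ (fun w => c (sq w false) (sq w true)).
  (* The embedding given by the line: a vertex repeats itself in the moving coordinates and takes
     the matching end of the fixed edge in the others. The moving coordinate [i0] makes it injective
     and the copy induced. *)
  pose f : {ffun V -> B} := [ffun v => let s := p v == b in
    (s, [ffun i => if t i is Some e then (if s then (val e).2 else (val e).1) else v])].
  have Pf : P f.
    apply/and3P; split.
    - by apply/forall_inP => x _; rewrite ffunE.
    - apply/forall_inP => x _; apply/forall_inP => y _; apply/implyP; rewrite !ffunE.
      by case/eqP=> _ /ffunP/(_ i0); rewrite !ffunE ti0 => ->.
    - apply/forall_inP => x xT; apply/forall_inP => y yT; rewrite !ffunE /EB /=.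
      have [px|pxb] := eqVneq (p x) b; last (have px : p x = a
        by move: xT; rewrite inE (negPf pxb) orbF => /eqP);
      (have [py|pyb] := eqVneq (p y) b; last have py : p y = a
        by move: yT; rewrite inE (negPf pyb) orbF => /eqP); rewrite /=.
      + by apply/eqP; apply/esym/negP => /Ep; rewrite px py eqxx.
      + rewrite (ES x); apply/eqP; apply/forallP/idP => [/(_ i0)|Eyx i].
          by rewrite !ffunE ti0 => /and3P[].
        rewrite !ffunE; case: (t i) => [[[u v] De]|] //=.
        by rewrite /isD /= Eyx px py !eqxx.
      + apply/eqP; apply/forallP/idP => [/(_ i0)|Exy i].
          by rewrite !ffunE ti0 => /and3P[].
        rewrite !ffunE; case: (t i) => [[[u v] De]|] //=.
        by rewrite /isD /= Exy px py !eqxx.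
      + by apply/eqP; apply/esym/negP => /Ep; rewrite px py eqxx.
  exists (glue_map T f); split.
  - by move=> x; apply: p'map.
  - by move=> x y; rewrite gm.
  - exists k => x y Exy px py.
    have De : isD (x, y) by rewrite /isD /= Exy px py !eqxx.
    rewrite -(ck (Sub (x, y) De)) /glue_map !inE px py !eqxx orbT /=; congr c; congr inl.
    + rewrite /f ffunE px (negPf ab); congr (_, _); apply/ffunP => i; rewrite !ffunE.
      by case: (t i).
    + rewrite /f ffunE py eqxx; congr (_, _); apply/ffunP => i; rewrite !ffunE.
      by case: (t i).
Qed.

(** The maps of the successive steps are composed. Each is a homomorphism preserving the parts, so
    the colouring can be pulled back along the later map before the earlier step is applied. *)
Lemma partite_iter (V : finType) (E : rel V) (p : V -> 'I_m) (F : seq ('I_m * 'I_m)) :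
  0 < r -> all (fun f => f.1 != f.2) F ->
  symmetric E -> (forall x y, E x y -> p x != p y) -> K4free E ->
  exists (V' : finType) (E' : rel V') (p' : V' -> 'I_m),
    [/\ symmetric E', forall x y, E' x y -> p' x != p' y, K4free E' &
     forall c : V' -> V' -> 'I_r, exists h : V -> V',
       [/\ forall x, p' (h x) = p x, forall x y, E x y -> E' (h x) (h y) &
        forall a b, (a, b) \in F ->
          exists k, forall x y, E x y -> p x = a -> p y = b -> c (h x) (h y) = k]].
Proof.
move=> r0 + ES Ep K4; elim: F => [|[a b] F IHF] /=.
  by exists V, E, p; split=> // c; exists id.
case/andP=> ab /IHF[V1 [E1 [p1 [E1S E1p E1K H1]]]].
have [V2 [E2 [p2 [E2S E2p E2K H2]]]] := partite_step r0 ab E1S E1p E1K.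
exists V2, E2, p2; split=> // c; have [h2 [h2p h2E [k2 h2k]]] := H2 c.
have [h1 [h1p h1E h1k]] := H1 (fun x y => c (h2 x) (h2 y)).
exists (h2 \o h1); split=> [x|x y /h1E/h2E|a' b'] //=; first by rewrite h2p.
rewrite inE => /orP[/eqP[-> ->]|/h1k //]; exists k2 => x y /h1E Exy px py.
by apply: h2k; rewrite ?h1p.
Qed.
End Partite.

(** The iteration starts from a disjoint union with a triangle for each triple [t] of distinct
    labels in ['I_m], the labels being the parts. Once any two parts have one colour between them,
    the labels are coloured like a complete graph; a monochromatic triple of labels is realised by
    its own triangle. *)
Lemma K4free_ramsey r : 0 < r -> exists (V : finType) (E : rel V),
  [/\ simple_graph E, K4free E & ramsey_K3 r E].
Proof.
move=> r0; have [m Hm] := ramsey_complete r.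
pose V := ('I_m * 'I_m * 'I_m * 'I_m)%type.
pose ht (t : 'I_m * 'I_m * 'I_m) := [:: t.1.1; t.1.2; t.2].
pose E (x y : V) := [&& x.1 == y.1, x.2 != y.2, x.2 \in ht x.1 & y.2 \in ht y.1].
have ES : symmetric E.
  by move=> x y; rewrite /E (eq_sym y.1) (eq_sym y.2) [in RHS](andbC (y.2 \in _)).
have Ep x y : E x y -> x.2 != y.2 by case/and4P.
have K4 : K4free E.
  move=> s s4; apply/negP; case: s s4 => [|x s] // s4 cs.
  have xs : all (E x) s by case/andP: cs.
  have : size (map snd (x :: s)) <= size (ht x.1).
    apply: uniq_leq_size.
      rewrite uniq_pairwise pairwise_map; apply: sub_pairwise cs => u v; exact: Ep.
    move=> i /= ; rewrite inE => /orP[/eqP ->|/mapP[y ys ->]].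
      by case: s s4 xs {cs} => // y s _ /= /andP[/and4P[]].
    by have /allP/(_ y ys)/and4P[/eqP -> _ _] := xs.
  by rewrite size_map s4.
pose F := [seq f <- enum {: 'I_m * 'I_m} | f.1 != f.2].
have [|V' [E' [p' [ES' Ep' K4' H]]]] := partite_iter (F := F) r0 _ ES Ep K4.
  by apply/allP => f; rewrite mem_filter => /andP[].
exists V', E'; split=> //; first by split=> // x; apply/negP => /Ep'; rewrite eqxx.
move=> c cS; have [h [hp hE hk]] := H c.
have [k kP] : exists k : 'I_m -> 'I_m -> 'I_r, forall x y, E x y -> c (h x) (h y) = k x.2 y.2.
  pose Q (i : 'I_m * 'I_m) k := forall x y, E x y -> x.2 = i.1 -> y.2 = i.2 -> c (h x) (h y) = k.
  have kex i : exists k, Q i k.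
    case: i => a b; have [->|ab] := eqVneq a b.
      exists (Ordinal r0) => x y /Ep + px py.
      by rewrite px py eqxx.
    by apply: hk; rewrite mem_filter ab mem_enum.
  have [k kP] : exists k, forall i, Q i (k i).
    exact: fin_all_exists.
  by exists (fun a b => k (a, b)) => x y Exy; apply: kP.
have [//|x [y [z]]] := Hm (fun a b => if a < b then k a b else k b a).
  move=> x y; have [||/val_inj ->] := ltngtP x y => //.
case/and5P=> xy yz xz /eqP e1 /eqP e2.
pose t := (x, y, z); exists (h (t, x)), (h (t, y)), (h (t, z)).
have tt a b : a \in ht t -> b \in ht t -> a != b -> E (t, a) (t, b).
  by move=> at_ bt ab; rewrite /E /= eqxx ab at_ bt.
have [xt yt zt] : [/\ x \in ht t, y \in ht t & z \in ht t].
  by rewrite !inE !eqxx !orbT.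
have ck a b : a \in ht t -> b \in ht t -> a != b ->
    c (h (t, a)) (h (t, b)) = if a < b then k a b else k b a.
  move=> at_ bt ab; case: ifP => _; first exact: kP (tt _ _ at_ bt ab).
  by rewrite cS; apply: kP (tt _ _ bt at_ _); rewrite eq_sym.
by rewrite !hE ?tt // !ck // e1 -e2 e1 !eqxx.
Qed.

(** * Star gadgets *)

Lemma exists_min (X : Type) (P : X -> Prop) (f : X -> nat) :
  (exists x, P x) -> exists2 x, P x & forall y, P y -> f x <= f y.
Proof.
case=> x0; have [n] := ubnP (f x0); elim: n x0 => [|n IHn] x0 //; rewrite ltnS => fn Px0.
have [[y Py fy]|no] := classic (exists2 y, P y & f y < f x0).
  by apply: IHn Py; apply: leq_trans fn.
by exists x0 => // y Py; rewrite leqNgt; apply/negP => lt; apply: no; exists y.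
Qed.

(** [Z] is the set of common neighbours of [x] and [y] after the edge [xy] is removed from an
    edge-minimal [K_4]-free Ramsey graph. If all edges from [x] to [Z] had colour [k], restoring
    [xy] in another colour would create no monochromatic triangle. *)
Lemma nonmono_star r : 1 < r -> exists (V : finType) (E : rel V) (x : V) (Z : {set V}),
  [/\ simple_graph E, {in Z, forall z, E x z}, {in Z &, forall y z, ~~ E y z},
    exists c : V -> V -> 'I_r, good_col E c &
    forall (c : V -> V -> 'I_r) k, good_col E c -> ~ {in Z, forall z, c x z = k}].
Proof.
move=> r1; have [V [E0 [[E0S E0I] K4 R0]]] := K4free_ramsey (ltnW r1).
pose e (S : {set V * V}) : rel V := fun x y => (x, y) \in S.
pose Q S := [/\ symmetric (e S), subrel (e S) E0 & ramsey_K3 r (e S)].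
have [|S [SS SE SR] Smin] := @exists_min _ Q (fun S => #|S|).
  exists [set p | E0 p.1 p.2]; split=> [x y|x y|].
  - by rewrite /e !inE /= E0S.
  - by rewrite /e inE.
  - move=> c /R0[x [y [z H]]]; exists x, y, z.
    by rewrite /e !inE /=.
have SI x : e S x x = false by apply/negP => /SE; rewrite E0I.
have [x [y [_ /and5P[Sxy _ _ _ _]]]] := SR (fun _ _ => Ordinal r1) (fun _ _ => erefl).
pose S' := S :\ (x, y) :\ (y, x).
have S'E u v : e S' u v = [&& (u, v) != (y, x), (u, v) != (x, y) & e S u v].
  by rewrite /e /S' !inE.
have S'S : symmetric (e S').
  by move=> u v; rewrite !S'E SS !xpair_eqE; do !case: eqP.
have nR : ~ ramsey_K3 r (e S').
  move=> R'; suff /Smin : Q S'.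
    by rewrite (cardsD1 (x, y) S) -/(e S x y) Sxy /S' leqNgt ltnS subset_leq_card ?subsetDl.
  by split=> // u v; rewrite S'E => /and3P[_ _ /SE].
have xy : x != y by apply/negP => /eqP xy; rewrite xy SI in Sxy.
exists V, (e S'), x, [set z | e S' x z && e S' y z]; split.
- by split=> // u; rewrite S'E SI !andbF.
- by move=> z; rewrite inE => /andP[].
- move=> z z'; rewrite !inE !S'E => /andP[/and3P[_ _ xz] /and3P[_ _ yz]].
  case/andP=> /and3P[_ _ xz'] /and3P[_ _ yz']; apply/negP => /and3P[_ _ zz'].
  have /negP := K4 [:: x; y; z; z'] erefl; apply.
  by rewrite /= !andbT !SE.
- by apply/not_ramseyE.
move=> c k [cS cG] cZ; pose i : 'I_r := if k == Ordinal r1 then Ordinal (ltnW r1) else Ordinal r1.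
have ik : i != k by rewrite /i; have [->|] := eqVneq k (Ordinal r1); rewrite // eq_sym.
pose sp u v := ((u, v) == (x, y)) || ((u, v) == (y, x)).
have spS u v : sp u v = sp v u by rewrite /sp !xpair_eqE; do !case: eqP.
pose c' u v := if sp u v then i else c u v.
have c'S u v : c' u v = c' v u by rewrite /c' spS cS.
have notsp u v : e S u v -> ~~ sp u v -> e S' u v.
  by rewrite S'E negb_or => -> /andP[-> ->].
(* A monochromatic triangle on the restored edge has its third vertex in [Z], so it would contain
   both colour [i] and colour [k]. *)
have third u v w : e S u v -> e S v w -> e S u w -> sp u v -> c' u v = c' v w -> c' u v = c' u w -> False.
  move=> uv vw uw s; have [nvw nuw] : ~~ sp v w /\ ~~ sp u w.
    split; apply/negP; (case/orP: s => /eqP[eu ev]; subst u v); case/orP=> /eqP[]; intros; subst;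
    by move: xy vw uw; rewrite ?SI ?eqxx.
  rewrite /c' s (negPf nvw) (negPf nuw) => e1 e2.
  have {vw uw} [vw uw] := (notsp _ _ vw nvw, notsp _ _ uw nuw).
  move: ik; rewrite -(cZ w) ?inE.
    by case/orP: s => /eqP[eu ev]; subst; rewrite -?e1 -?e2 eqxx.
  by case/orP: s => /eqP[eu ev]; subst; rewrite vw uw.
have [u [v [w /and5P[uv vw uw /eqP e1 /eqP e2]]]] := SR c' c'S.
have [s1|n1] := boolP (sp u v); first exact: (third u v w).
have [s2|n2] := boolP (sp v w); first by apply: (third v w u); rewrite ?[e S w u]SS ?[e S v u]SS // -?e1 1?[RHS]c'S // e2.
have [s3|n3] := boolP (sp u w); first by apply: (third u w v); rewrite ?[e S w v]SS // -?e2 1?[RHS]c'S.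
apply: (cG u v w); rewrite ?notsp //; first by move: e1; rewrite /c' (negPf n1) (negPf n2).
by move: e2; rewrite /c' (negPf n1) (negPf n3).
Qed.

Lemma star_gadget r : 1 < r -> exists (V : finType) (E : rel V) (x : V) (A : {set V}) (b : V),
  [/\ simple_graph E, b \notin A, {in b |: A, forall z, E x z},
    {in b |: A &, forall y z, ~~ E y z} &
    (forall j j' : 'I_r, j != j' ->
       exists c, [/\ good_col E c, {in A, forall a, c x a = j} & c x b = j']) /\
    (forall (c : V -> V -> 'I_r) k, good_col E c -> {in A, forall a, c x a = k} -> c x b != k)].
Proof.
move=> r1; have [V [E [x [Z [sE xZ indZ [c0 c0G] nm]]]]] := nonmono_star r1.
pose Q (A : {set V}) := A \subset Z /\ exists (c : V -> V -> 'I_r) k,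
  good_col E c /\ {in A, forall z, c x z = k}.
have [|A [AZ [c [k [cG cA]]]] Amax] := @exists_min _ Q (fun A => #|~: A|).
  by exists set0; split; [exact: sub0set|exists c0, (Ordinal r1); split=> // z; rewrite inE].
have /subsetPn[b bZ bA] : ~~ (Z \subset A).
  by apply/negP => /subsetP ZA; apply: (nm c k cG) => z /ZA; apply: cA.
have bAZ : b |: A \subset Z by rewrite subUset sub1set bZ.
have cb (c' : V -> V -> 'I_r) k' : good_col E c' -> {in A, forall a, c' x a = k'} -> c' x b != k'.
  move=> c'G c'A; apply/negP => /eqP e; have /Amax : Q (b |: A).
    split=> //; exists c', k'; split=> // z; rewrite !inE => /orP[/eqP ->//|]; exact: c'A.
  by have := cardsC A; have := cardsC (b |: A); rewrite cardsU1 bA; lia.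
exists V, E, x, A, b; split=> //; first by move=> z /(subsetP bAZ); apply: xZ.
  by move=> y z /(subsetP bAZ) yZ /(subsetP bAZ) zZ; apply: indZ.
split=> // j j' jj'.
(* The first transposition takes [k] to [j]; the second takes the image of [c x b] to [j'] and fixes
   [j]. *)
pose s1 := tperm k j; pose s := (s1 * tperm (s1 (c x b)) j')%g.
have nj : s1 (c x b) != j.
  apply/negP => /eqP e; have /perm_inj e' : s1 (c x b) = s1 k by rewrite e /s1 tpermL.
  by have := cb c k cG cA; rewrite e' eqxx.
exists (fun u v => s (c u v)); split.
- exact: good_col_perm (@perm_inj _ s) cG.
- by move=> a aA; rewrite (cA a aA) /s permM tpermL tpermD // eq_sym.
- by rewrite /s permM tpermL.
Qed.

(* Each vertex of the core gets [M] pendant edges for each colour [j], and the star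
   gadget is glued wherever [A] lies in the pendant edges of colour [j] and [b] on an
   edge of another colour.  So the majority colour [s j] of the [j]-th bundle is avoided by
   all edges not coloured [j]. *)
Lemma rainbow_core r (C : finType) (EC : rel C) (chi : C -> C -> 'I_r) :
  1 < r -> simple_graph EC -> good_col EC chi ->
  exists (V : finType) (E : rel V) (h : C -> V),
    [/\ simple_graph E, forall u w, EC u w -> E (h u) (h w),
        exists c : V -> V -> 'I_r, good_col E c &
        forall c : V -> V -> 'I_r, good_col E c -> forall u, exists2 s : 'I_r -> 'I_r,
          injective s & forall w, EC u w -> c (h u) (h w) = s (chi u w)].
Proof.
move=> r1 [ECS ECI] [chiS chiG].
have [V [E [x [A [b [[ES EI] bA xZ indZ [real forced]]]]]]] := star_gadget r1.
have xb : x != b by apply/negP => /eqP e; have := xZ b (setU11 _ _); rewrite -e EI.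
have xA : x \notin A by apply/negP => xA; have := xZ x (setU1r _ xA); rewrite EI.
(* By pigeonhole some colour occurs on more than [#|A|] edges of each bundle, so [A] fits into
   them. *)
pose M := (r * #|A|).+1.
pose B : finType := (C + C * 'I_r * 'I_M)%type.
pose EB : rel B := fun u w => match u, w with
  | inl u, inl w => EC u w
  | inl u, inr (u', _, _) | inr (u', _, _), inl u => u == u'
  | _, _ => false end.
pose chiB (u w : B) : 'I_r := match u, w with
  | inl u, inl w => chi u w
  | inl _, inr (_, j, _) | inr (_, j, _), inl _ => j
  | _, _ => Ordinal r1 end.
have EBS : symmetric EB by move=> [u|[[u i] s]] [w|[[w j] t]] //=.
have EBI : irreflexive EB by move=> [u|[[u i] s]] //=.
have chiBG : good_col EB chiB.
  split=> [[u|[[u i] s]] [w|[[w j] t]] //=|].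
  case=> [u|[[u i] s]] [w|[[w j] t]] [v|[[v k] l]] //=; first exact: chiG.
  - by move=> uw /eqP <- /eqP e; move: uw; rewrite e ECI.
  - by move=> /eqP -> /eqP ->; rewrite ECI.
  - by move=> /eqP -> + /eqP e; rewrite e ECI.
pose T : {pred V} := [pred v | v \in x |: (b |: A)].
have TE t : (t \in T) = [|| t == x, t == b | t \in A] by rewrite !inE.
have TP t : t \in T -> [\/ t = x, t = b | t \in A].
  by rewrite TE => /or3P[/eqP ->|/eqP ->|]; [constructor 1|constructor 2|constructor 3].
pose P (f : {ffun V -> B}) := [&&
  [forall t in T, forall t' in T, (f t == f t') ==> (t == t')],
  [forall t in T, forall t' in T, EB (f t) (f t') == E t t'] &
  [exists j, [forall a in A, chiB (f x) (f a) == j] && (chiB (f x) (f b) != j)]].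
have PI f : P f -> {in T &, injective f}.
  case/and3P=> /forall_inP I _ _ t t' tT t'T e.
  by have /forall_inP/(_ t' t'T) := I t tT; rewrite e eqxx => /eqP.
have PE f : P f -> {in T &, forall t t', EB (f t) (f t') = E t t'}.
  case/and3P=> _ /forall_inP I _ t t' tT t'T.
  by have /forall_inP/(_ t' t'T)/eqP := I t tT.
(* Each attached gadget is coloured by [real] so that its star agrees with the core: one colour on
   [A], another at [b]. *)
have [cV cVP] : exists cV : {ffun V -> B} -> V -> V -> 'I_r, forall f, P f ->
    good_col E (cV f) /\ {in T &, forall t t', E t t' -> cV f t t' = chiB (f t) (f t')}.
  apply: (@fin_all_exists _ (fun=> V -> V -> 'I_r) (fun f c => P f ->
    good_col E c /\ {in T &, forall t t', E t t' -> c t t' = chiB (f t) (f t')})) => f.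
  have [Pf|_] := boolP (P f); last by exists (fun _ _ => Ordinal r1).
  have /and3P[_ _ /existsP[j /andP[/forall_inP fA fb]]] := Pf.
  rewrite eq_sym in fb; have [c [cG cA cb]] := real _ _ fb; exists c => _; split=> // t t'.
  have cx t1 : t1 \in b |: A -> c x t1 = chiB (f x) (f t1).
    by rewrite in_setU1 => /orP[/eqP ->//|t1A]; rewrite (eqP (fA _ t1A)) cA.
  rewrite !TE -(in_setU1 t b) -(in_setU1 t' b) => /orP[/eqP ->|tA] /orP[/eqP ->|t'A]; rewrite ?EI //.
  - by move=> _; apply: cx.
  - by move=> _; rewrite cG.1 chiBG.1; apply: cx.
  - by rewrite (negPf (indZ _ _ tA t'A)).
exists (B + {ffun V -> B} * V)%type, (glue EB E T P), (fun u => inl (inl u)); split.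
- by split; [apply: glue_sym|apply: glue_irr].
- by [].
- exists (glue_col T P chiB cV); apply: glue_col_good => // f Pf; first exact: (cVP f Pf).1.
  exact: (cVP f Pf).2.
move=> c cG u.
have [s sP] : exists s : 'I_r -> 'I_r, forall j,
    #|A| < #|[set l : 'I_M | c (inl (inl u)) (inl (inr (u, j, l))) == s j]|.
  apply: (@fin_all_exists _ (fun=> 'I_r) (fun j k =>
    #|A| < #|[set l : 'I_M | c (inl (inl u)) (inl (inr (u, j, l))) == k]|)) => j.
  have [|k] := @pigeonhole r #|A| _ setT (fun l : 'I_M => c (inl (inl u)) (inl (inr (u, j, l)))).
    by rewrite cardsT card_ord.
  move=> lt; exists k; apply: leq_trans lt (subset_leq_card _).
  by apply/subsetP => l; rewrite !inE.
(* If the edge to [w] had colour [s j], the gadget with [A] on edges of bundle [j] coloured [s j]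
   and with [b] at [w] would violate [forced]. *)
have key j w : EB (inl u) w -> chiB (inl u) w != j -> c (inl (inl u)) (inl w) != s j.
  move=> uw wj; pose L := [set l : 'I_M | c (inl (inl u)) (inl (inr (u, j, l))) == s j].
  have AL : #|A| < #|L| := sP j.
  have Lidx a : a \in A -> index a (enum A) < size (enum L).
    by move=> aA; rewrite -cardE; apply: leq_trans AL; rewrite ltnS ltnW // [in X in _ < X]cardE index_mem mem_enum.
  pose lf a : B := inr (u, j, nth ord0 (enum L) (index a (enum A))).
  pose f : {ffun V -> B} := [ffun v => if v == x then inl u else if v == b then w else lf v].
  have fx : f x = inl u by rewrite ffunE eqxx.
  have fb : f b = w by rewrite ffunE eq_sym (negPf xb) eqxx.
  have fA a : a \in A -> f a = lf a.
    move=> aA; rewrite ffunE; case: eqP => [e|_]; first by rewrite -e aA in xA.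
    by case: eqP => // e; rewrite -e aA in bA.
  have wu : w <> inl u by move=> e; rewrite e EBI in uw.
  have wl a : w <> lf a by move=> e; rewrite e /= eqxx in wj.
  have Pf : P f.
    apply/and3P; split.
    - apply/forall_inP => t /TP tT; apply/forall_inP => t' /TP tT'; apply/implyP.
      case: tT tT' => [->|->|tA] [->|->|t'A]; rewrite ?fx ?fb ?fA // => /eqP.
      + by move/esym.
      + by [].
      + by move/wl.
      + by move/esym/wl.
      + case=> /eqP; rewrite nth_uniq ?enum_uniq ?Lidx // => /eqP e.
        by rewrite -(nth_index x (s := enum A) (x := t)) ?mem_enum // e nth_index ?mem_enum.
    - apply/forall_inP => t /TP tT; apply/forall_inP => t' /TP tT'.
      have xb' : E x b by apply: xZ; rewrite setU11.
      have xA' a : a \in A -> E x a by move=> aA; apply: xZ; rewrite setU1r.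
      have wla a : EB w (lf a) = false.
        by case: (w) uw wu => [v|[[v ?] ?]] //= _ e; apply/negP => /eqP ev; apply: e; rewrite ev.
      have ind y z : y \in b |: A -> z \in b |: A -> E y z = false.
        by move=> yA zA; apply/negbTE/indZ.
      case: tT tT' => [->|->|tA] [->|->|t'A]; rewrite ?fx ?fb ?fA //.
      + by rewrite EBI EI.
      + by rewrite uw xb'.
      + by rewrite xA' //= eqxx.
      + by rewrite EBS uw ES xb'.
      + by rewrite EBI EI.
      + by rewrite wla ind ?setU11 ?setU1r.
      + by rewrite ES xA' //= eqxx.
      + by rewrite EBS wla ind ?setU11 ?setU1r.
      + by rewrite ind ?setU1r.
    - apply/existsP; exists j; rewrite fx fb wj andbT.
      by apply/forall_inP => a aA; rewrite fA.
  have gm v : v \in T -> glue_map T f v = inl (f v) by rewrite /glue_map => ->.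
  have cfG : good_col E (fun v v' => c (glue_map T f v) (glue_map T f v')).
    by apply: good_col_pull cG => v v' Evv; rewrite glue_mapE.
  have := forced _ (s j) cfG; rewrite !gm ?TE ?eqxx ?orbT // fx fb; apply.
  move=> a aA; rewrite gm ?TE ?aA ?orbT // fA //.
  have : nth ord0 (enum L) (index a (enum A)) \in L by rewrite -mem_enum mem_nth // Lidx.
  by rewrite inE => /eqP.
(* A pendant edge of bundle [j] with colour [s j] must avoid [s j'] for every other [j']. *)
have sI : injective s.
  move=> j j' e; apply/eqP/negP => /negP jj'.
  have /card_gt0P[l] : 0 < #|[set l : 'I_M | c (inl (inl u)) (inl (inr (u, j, l))) == s j]|.
    by apply: leq_trans (sP j).
  rewrite inE => /eqP cl; have := key j' (inr (u, j, l)) (eqxx _) jj'.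
  by rewrite cl e eqxx.
exists s => // w uw; have [g _ gK] := injF_bij sI.
rewrite -[LHS]gK; congr s; apply/eqP/negP => /negP ne.
by have := key (g (c (inl (inl u)) (inl (inl w)))) (inl w) uw; rewrite eq_sym gK eqxx; move/(_ ne).
Qed.

(** * Forcing a colour pattern *)

(** [g p] stands for the colour of an edge from an added vertex to [p]: every colouring of these
    edges closes a monochromatic triangle with the pattern. *)
Definition star_blocking r (W : finType) (EW : rel W) (chi : W -> W -> 'I_r) : Prop :=
  forall g : W -> 'I_r, exists p q, [/\ EW p q, g p = chi p q & g q = chi p q].

Lemma pattern_core r (W : finType) (EW : rel W) (chi : W -> W -> 'I_r) :
  1 < r -> simple_graph EW -> good_col EW chi ->
  exists (V : finType) (E : rel V) (h : W -> V),
    [/\ simple_graph E, forall p q, EW p q -> E (h p) (h q),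
        exists c : V -> V -> 'I_r, good_col E c &
        forall c : V -> V -> 'I_r, good_col E c -> exists2 s : 'I_r -> 'I_r,
          injective s & forall p q, EW p q -> c (h p) (h q) = s (chi p q)].
Proof.
move=> r1 [ES EI] [cS cG].
(* Paths [p -- (p, i) -- tt] of colour [i] make the permutations at all [p] equal
   to the one at the hub [tt]. *)
pose C : finType := (W + (W * 'I_r + unit))%type.
pose EC : rel C := fun u w => match u, w with
  | inl p, inl q => EW p q
  | inl p, inr (inl (q, _)) | inr (inl (q, _)), inl p => p == q
  | inr (inl _), inr (inr _) | inr (inr _), inr (inl _) => true
  | _, _ => false end.
pose chiC (u w : C) : 'I_r := match u, w with
  | inl p, inl q => chi p q
  | inl _, inr (inl (_, i)) | inr (inl (_, i)), inl _
  | inr (inl (_, i)), inr (inr _) | inr (inr _), inr (inl (_, i)) => i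
  | _, _ => Ordinal r1 end.
have [||V [E [h [sE hE good forced]]]] := rainbow_core (EC := EC) (chi := chiC) r1.
- by split=> [[p|[[p i]|[]]] [q|[[q j]|[]]] //=|[p|[[p i]|[]]] //=].
- split=> [[p|[[p i]|[]]] [q|[[q j]|[]]] //=|].
  case=> [p|[[p i]|[]]] [q|[[q j]|[]]] [t|[[t k]|[]]] //=; first exact: cG.
  + by move=> pq /eqP <- /eqP e; move: pq; rewrite e EI.
  + by move=> /eqP -> /eqP ->; rewrite EI.
  + by move=> /eqP -> + /eqP e; rewrite e EI.
exists V, E, (h \o inl); split=> // [p q pq|c cG']; first exact: hE.
have [s sI sP] := forced c cG' (inr (inr tt)); exists s => // p q pq /=.
have [sp _ spP] := forced c cG' (inl p).
rewrite (spP (inl q) pq) /=; set i := chi p q.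
have [sm _ smP] := forced c cG' (inr (inl (p, i))).
(* The edges from [(p, i)] to [p] and to the hub both have pattern colour [i], so they get the same
   colour: it is [sp i] read at [p] and [s i] read at the hub. *)
have := spP (inr (inl (p, i))) (eqxx p); rewrite /= => <-.
have := smP (inl p) (eqxx p); rewrite /= cG'.1 => ->.
have := smP (inr (inr tt)) isT; rewrite /= => <-.
by rewrite cG'.1 (sP (inr (inl (p, i)))).
Qed.

Lemma ramsey_small_degree r (W : finType) (EW : rel W) (chi : W -> W -> 'I_r) :
  1 < r -> simple_graph EW -> good_col EW chi -> star_blocking EW chi ->
  exists (V : finType) (E : rel V) (v : V),
    [/\ simple_graph E, ramsey_K3 r E, degree E v <= #|W| &
     ~ ramsey_K3 r (fun x y => [&& E x y, x != v & y != v])].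
Proof.
move=> r1 sW cW blk.
have [V [E [h [[ES EI] hE [c0 c0G] forced]]]] := pattern_core r1 sW cW.
pose E' : rel (option V) := fun u w => match u, w with
  | Some u, Some w => E u w
  | None, Some w | Some w, None => w \in codom h
  | None, None => false end.
exists (option V), E', None; split.
- by split=> [[u|] [w|] //=|[u|] //=].
- apply: NNPP => /not_ramseyE[c cG].
  have [s sI sP] := forced _ (good_col_pull (h := Some) (F := E') (fun _ _ e => e) cG).
  have [g gK sK] := injF_bij sI.
  have [p [q [pq gp gq]]] := blk (fun p => g (c None (Some (h p)))).
  have cp : c None (Some (h p)) = s (chi p q) by rewrite -gp sK.
  have cq : c None (Some (h q)) = s (chi p q) by rewrite -gq sK.
  apply: (cG.2 None (Some (h p)) (Some (h q))); rewrite /= ?codom_f ?hE //.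
    by rewrite cp sP.
  by rewrite cp cq.
- rewrite /degree; have -> : [set u | E' None u] = Some @: [set u in codom h].
    apply/setP => -[u|]; rewrite !inE /=; last by apply/esym/imsetP => -[].
    by apply/idP/imsetP => [uh|[u' + [->]]]; rewrite ?inE //; exists u; rewrite ?inE.
  rewrite card_imset; last by move=> ? ? [].
  by rewrite cardsE; apply: leq_trans (card_size _) _; rewrite size_codom.
- apply/not_ramseyE; exists (fun u w => if u is Some u then if w is Some w then c0 u w else Ordinal r1 else Ordinal r1).
  split=> [[u|] [w|] //=|[u|] [w|] [t|] //=]; first by rewrite c0G.1.
  all: by rewrite ?andbT ?andbF //; apply: c0G.2.
Qed.

Lemma minimal_small_degree r n (V : finType) (E : rel V) (v : V) :
  simple_graph E -> ramsey_K3 r E -> degree E v <= n ->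
  ~ ramsey_K3 r (fun x y => [&& E x y, x != v & y != v]) ->
  exists (V' : finType) (E' : rel V') (v' : V'), ramsey_minimal_K3 r E' /\ degree E' v' <= n.
Proof.
move=> sE RE dv nR.
(* Passing to a Ramsey subgraph keeps a set [J] of vertices of degree at most [n]
   without which the graph is not Ramsey; hence [J] never becomes empty. *)
pose Q (G : {V : finType & rel V}) := let: existT V E := G in
  [/\ simple_graph E, ramsey_K3 r E & exists J : {set V},
    (forall v, v \in J -> degree E v <= n) /\
    ~ ramsey_K3 r (fun x y => [&& E x y, x \notin J & y \notin J])].
(* Vertices plus ordered adjacent pairs: a proper subgraph is strictly smaller whether it loses a
   vertex or an edge. *)
pose f (G : {V : finType & rel V}) := let: existT V E := G in #|V| + #|[set p | E p.1 p.2]|.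
have [|[V' E'] [sE' RE' [J [Jd JR]]] Gmin] := @exists_min _ Q f.
  exists (existT (fun V : finType => rel V) V E); split=> //; exists [set v].
  split=> [u /set1P -> //|R]; apply: nR => c /R [x [y [z H]]]; exists x, y, z.
  by move: H; rewrite !inE.
have [v' v'J] : exists v', v' \in J.
  apply: NNPP => no; apply: JR => c /RE' [x [y [z H]]]; exists x, y, z.
  have nJ u : u \notin J by apply/negP => uJ; apply: no; exists u.
  by rewrite !nJ !andbT.
exists V', E', v'; split; last exact: Jd.
split=> //; split=> // A F [[FS FA] prop] RF.
have FE x y : F x y -> E' x y by case/FA/and3P.
have vE : [set p : V' * V' | F p.1 p.2] \subset [set p | E' p.1 p.2].
  by apply/subsetP => -[x y]; rewrite !inE => /FE.
have sle : #|[set p | sub_rel A F p.1 p.2]| <= #|[set p : V' * V' | F p.1 p.2]|.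
  rewrite -(card_imset _ (f := fun p : {x | x \in A} * {x | x \in A} => (val p.1, val p.2))).
    apply/subset_leq_card/subsetP => _ /imsetP[p + ->]; by rewrite !inE.
  by move=> [x1 y1] [x2 y2] /= [/val_inj -> /val_inj ->].
have Ac : #|{: {x | x \in A}}| = #|A| by rewrite card_sig; apply: eq_card => x; rewrite inE.
have /Gmin : Q (existT (fun V : finType => rel V) {x | x \in A} (sub_rel A F)).
  split=> //; first by split=> [x y|x]; [apply: FS|apply/negP => /FE; rewrite sE'.2].
  exists [set x | val x \in J]; split.
    move=> x; rewrite inE => /Jd; apply: leq_trans; rewrite /degree -(card_imset _ val_inj).
    by apply/subset_leq_card/subsetP => _ /imsetP[u + ->]; rewrite !inE => /FE.
  apply/not_ramseyE; have /not_ramseyE[c cG] := JR.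
  exists (fun x y => c (val x) (val y)); apply: good_col_pull cG => x y /and3P[/FE -> ].
  by rewrite !inE => -> ->.
rewrite /= Ac leqNgt => /negP; apply; case: prop => [AT|[x [y /andP[Exy nF]]]].
  rewrite -addSn leq_add //; last exact: leq_trans sle (subset_leq_card vE).
  by rewrite -cardsT proper_card // properT.
rewrite -addnS leq_add ?max_card //; apply: leq_ltn_trans sle (proper_card _).
by apply/properP; split=> //; exists (x, y); rewrite inE.
Qed.

(** * The local lemma *)

Section LocalLemma.
Import ring lra.
Import Order.TTheory GRing.Theory Num.Theory.
Local Open Scope ring_scope.

Lemma prod_oneminus_ge (R : realFieldType) (J : finType) (P : pred J) (x : J -> R) :
  (forall j, 0 <= x j <= 1) -> 1 - \sum_(j | P j) x j <= \prod_(j | P j) (1 - x j).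
Proof.
move=> x01.
suff [] : [/\ 0 <= \prod_(j | P j) (1 - x j), \prod_(j | P j) (1 - x j) <= 1 &
  1 - \sum_(j | P j) x j <= \prod_(j | P j) (1 - x j)] by [].
elim/big_ind2: _ => [|p1 s1 p2 s2 [? ? ?] [? ? ?]|j _]; first by split; lra.
  by split; nra.
by case/andP: (x01 j) => ? ?; split; lra.
Qed.

Variables (X Y J : finType).
Local Notation Om := {ffun X -> Y}.
Variables (A : J -> {set Om}) (S : J -> {set X}).
Hypothesis A_dep : forall j (w w' : Om), {in S j, w =1 w'} -> (w \in A j) = (w' \in A j).

Definition avoid (Q : {set J}) : {set Om} := [set w | [forall j in Q, w \notin A j]].

Lemma avoid_dep (Q : {set J}) (w w' : Om) :
  (forall j, j \in Q -> {in S j, w =1 w'}) -> (w \in avoid Q) = (w' \in avoid Q).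
Proof.
move=> ww'; rewrite !inE; apply: eq_forallb_in => j jQ; congr negb; exact: A_dep (ww' j jQ).
Qed.

(* Exchanging the coordinates in [S j] of two outcomes is an involution. *)
Lemma avoid_indep j (Q : {set J}) : (forall l, l \in Q -> [disjoint S l & S j]) ->
  (#|A j :&: avoid Q| * #|Om| = #|A j| * #|avoid Q|)%N.
Proof.
move=> disj; pose mix (w1 w2 : Om) : Om := [ffun v => if v \in S j then w1 v else w2 v].
pose swap (p : Om * Om) := (mix p.1 p.2, mix p.2 p.1).
have swapK : involutive swap.
  by case=> w1 w2; congr (_, _); apply/ffunP => v; rewrite !ffunE; case: (v \in S j).
have mixA w1 w2 : (mix w1 w2 \in A j) = (w1 \in A j).
  by apply: A_dep => v vS; rewrite ffunE vS.
have mixQ w1 w2 : (mix w1 w2 \in avoid Q) = (w2 \in avoid Q).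
  apply: avoid_dep => l /disj dl v vS; rewrite ffunE.
  by rewrite (disjointFr dl vS).
rewrite -[#|Om|]cardsT -!cardsX -(card_imset (setX (A j) _) (inv_inj swapK)).
apply: eq_card => p; rewrite -[p in RHS]swapK mem_imset; last exact: inv_inj.
by case: p => w1 w2; rewrite !in_setX in_setI in_setT andbT /= mixA mixQ.
Qed.

Variables (R : realFieldType) (x : J -> R) (d : R).
Hypothesis Om_gt0 : (0 < #|Om|)%N.
Hypothesis x01 : forall j, 0 <= x j < 1.
Hypothesis d01 : 0 <= d <= 1.
Hypothesis x_var : forall v, \sum_(j | v \in S j) x j <= d.
Hypothesis A_small : forall j, #|A j|%:R <= x j * (1 - d) ^+ #|S j| * #|Om|%:R.

Let N (Q : {set J}) : R := #|avoid Q|%:R.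

(** The events are grouped by the first variable of [s] on which they depend; by [x_var] each group
    costs at most a factor [1 - d]. This bound stands in for the product over neighbours in the
    usual local lemma. *)
Lemma prod_nbr_ge (s : seq X) :
  (1 - d) ^+ size s <= \prod_(j | has [in S j] s) (1 - x j).
Proof.
have x1 j : 0 <= 1 - x j <= 1 by case/andP: (x01 j) => ? ?; lra.
have d1 : 0 <= 1 - d by case/andP: d01 => ? ?; lra.
elim: s => [|v s IHs] /=; first by rewrite big_pred0.
rewrite exprS (bigID (fun j => v \in S j)) /= ler_pM ?exprn_ge0 //.
- rewrite (eq_bigl (fun j => v \in S j)); last by move=> j /=; case: (v \in S j); rewrite ?andbF.
  apply: le_trans (prod_oneminus_ge _ _); first by have := x_var v; lra.
  by move=> j; case/andP: (x01 j) => ? ?; lra.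
- apply: le_trans IHs _; rewrite (bigID (fun j => v \in S j)) /=.
  rewrite -[leRHS]mul1r [X in _ <= _ * X](eq_bigl (fun j => has [in S j] s && (v \notin S j))).
    rewrite ler_wpM2r ?prodr_ge0 ?prodr_ile1 //.
    by move=> j _; case/andP: (x1 j).
  by move=> j; case: (v \in S j); rewrite ?andbF ?andbT.
Qed.

(** The induction of the local lemma, with counts in place of probabilities. [Q] is split into the
    events [G] sharing a variable with [A j] and the rest [Q'], of which [A j] is independent;
    adding [G] back costs at most a factor [(1 - d) ^+ #|S j|]. *)
Lemma avoid_step (Q : {set J}) j : j \notin Q -> (1 - x j) * N Q <= N (j |: Q).
Proof.
have [n] := ubnP #|Q|; elim: n Q j => [|n IHn] Q j //; rewrite ltnS => Qn jQ.
have x1 l : 0 <= 1 - x l <= 1 by case/andP: (x01 l) => ? ?; lra.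
pose G := [set l in Q | ~~ [disjoint S l & S j]].
pose Q' := Q :\: G.
(* The events of [G] are added to [Q'] one by one. The induction hypothesis applies because the
   event being added is still missing, so the current set is smaller than [Q]. *)
have chain (s : seq J) : uniq s -> {subset s <= G} ->
    \prod_(l <- s) (1 - x l) * N Q' <= N ([set l in s] :|: Q').
  elim: s => [|l s IHs] /=; first by rewrite big_nil mul1r; move=> _ _; rewrite set0U.
  case/andP=> ls us sG; rewrite big_cons -mulrA.
  have lG : l \in G by apply: sG; rewrite mem_head.
  have sG' : {subset s <= G} by move=> m ms; apply: sG; rewrite inE ms orbT.
  apply: le_trans (ler_wpM2l _ (IHs us sG')) _; first by case/andP: (x1 l).
  have -> : [set m in l :: s] :|: Q' = l |: ([set m in s] :|: Q').
    by apply/setP => m; rewrite !inE orbA.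
  have lQ : l \in Q by move: lG; rewrite inE => /andP[].
  apply: IHn; last by rewrite !inE (negPf ls) lQ; move: lG; rewrite inE lQ => ->.
  apply: leq_trans Qn; rewrite (cardsD1 l Q) lQ add1n ltnS.
  apply/subset_leq_card/subsetP => m; rewrite !inE => /orP[ms|/andP[mG mQ]].
    rewrite (memPn ls m ms) /=; by have := sG' m ms; rewrite inE => /andP[].
  rewrite mQ andbT; apply/eqP => ml; move: lG mG.
  by rewrite ml inE lQ /= => ->.
have NQ : \prod_(l in G) (1 - x l) * N Q' <= N Q.
  have := chain (enum G) (enum_uniq _); rewrite -big_enum /=.
  have -> : [set l in enum G] :|: Q' = Q.
    by apply/setP => l; rewrite !inE mem_enum !inE; case: (l \in Q); case: [disjoint _ & _].
  by apply=> l; rewrite mem_enum.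
have prodG : (1 - d) ^+ #|S j| <= \prod_(l in G) (1 - x l).
  rewrite cardE; apply: le_trans (prod_nbr_ge _) _.
  rewrite (bigID (mem G)) /= -[leRHS]mulr1.
  have sub : \prod_(l | has [in S l] (enum (S j)) && (l \in G)) (1 - x l) = \prod_(l in G) (1 - x l).
    apply: eq_bigl => l; have [lG|_] := boolP (l \in G); rewrite ?andbF // andbT.
    move: lG; rewrite inE => /andP[_] /pred0Pn[v /andP[vl vj]].
    by apply/hasP; exists v; rewrite // mem_enum.
  rewrite sub ler_wpM2l ?prodr_ge0 ?prodr_ile1 //; by move=> l _; case/andP: (x1 l).
have ind : #|A j :&: avoid Q'|%:R * #|Om|%:R = #|A j|%:R * N Q'.
  rewrite /N -!natrM avoid_indep // => l; rewrite !inE => /andP[+ lQ].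
  by rewrite lQ /= negbK.
have split_ : N (j |: Q) = N Q - #|A j :&: avoid Q|%:R.
  rewrite /N -(cardsID (A j) (avoid Q)) natrD setIC [X in X - _]addrC addrK; congr (#|pred_of_set _|%:R).
  apply/setP => w; rewrite !inE; apply/forall_inP/andP => [H|[wA /forall_inP H] l].
    split; first by apply: H; rewrite setU11.
    by apply/forall_inP => l lQ; apply: H; rewrite !inE lQ orbT.
  by rewrite !inE => /orP[/eqP ->|/H].
have sub : #|A j :&: avoid Q|%:R <= #|A j :&: avoid Q'|%:R :> R.
  rewrite ler_nat subset_leq_card // setIS //; apply/subsetP => w; rewrite !inE.
  move=> /forall_inP H; apply/forall_inP => l; rewrite !inE => /andP[_]; exact: H.
rewrite split_; have Om0 : 0 < #|Om|%:R :> R by rewrite ltr0n.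
suff : #|A j :&: avoid Q'|%:R <= x j * N Q by lra.
rewrite -(ler_pM2r Om0) ind.
apply: le_trans (ler_wpM2r (ler0n _ _) (A_small j)) _.
have key : (1 - d) ^+ #|S j| * N Q' <= N Q.
  by apply: le_trans NQ; rewrite ler_wpM2r // ler0n.
rewrite [leLHS](_ : _ = x j * ((1 - d) ^+ #|S j| * N Q') * #|Om|%:R); last by ring.
by rewrite ler_wpM2r ?ler_wpM2l //; case/andP: (x01 j).
Qed.

Lemma local_lemma : exists w, forall j, w \notin A j.
Proof.
suff : 0 < N setT.
  by rewrite ltr0n => /card_gt0P[w]; rewrite inE => /forall_inP H; exists w => j; apply: H.
suff H (s : seq J) : uniq s -> 0 < N [set l in s].
  have -> : [set: J] = [set l in enum J] by apply/setP => l; rewrite !inE mem_enum.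
  by apply: H; rewrite enum_uniq.
elim: s => [_|l s IHs /= /andP[ls /IHs s0]].
  rewrite ltr0n; apply: leq_trans Om_gt0 _; rewrite -cardsT subset_leq_card //.
  by apply/subsetP => w _; rewrite inE; apply/forall_inP => l; rewrite inE.
have -> : [set m in l :: s] = l |: [set m in s] by apply/setP => m; rewrite !inE.
apply: lt_le_trans (avoid_step _); last by rewrite inE.
by rewrite mulr_gt0 //; case/andP: (x01 l) => ? ?; lra.
Qed.
End LocalLemma.

(** * Packing triangle-free graphs without large independent sets *)

Lemma card_ffun_in (X Y : finType) (V : {set X}) (Z : {set Y}) :
  #|[set w : {ffun X -> Y} | [forall v in V, w v \in Z]]| * #|Y| ^ #|V| =
  #|Z| ^ #|V| * #|{ffun X -> Y}|.
Proof.
pose F v : {pred Y} := [pred y | (v \in V) ==> (y \in Z)].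
have -> : #|[set w : {ffun X -> Y} | [forall v in V, w v \in Z]]| = #|family F|.
  apply: eq_card => w; rewrite inE; apply/forall_inP/familyP => [H v|H v vV].
    by rewrite inE; apply/implyP => /H.
  by have := H v; rewrite inE vV.
rewrite card_family card_ffun foldrE big_map big_enum /= (bigID (mem V)) /=.
rewrite (eq_bigr (fun=> #|Z|)); last by move=> v vV; apply: eq_card => y; rewrite inE vV.
rewrite [X in _ * X * _](eq_bigr (fun=> #|Y|)); last first.
  by move=> v vV; apply: eq_card => y; rewrite inE (negPf vV).
rewrite !prod_nat_const -mulnA -expnD; congr (_ * _ ^ _).
rewrite -(cardC (mem V)) addnC; congr (_ + _).
Qed.

Lemma card_lt_pairs n (S : {set 'I_n}) :
  2 * #|[set p : 'I_n * 'I_n | [&& p.1 \in S, p.2 \in S & p.1 < p.2]]| + #|S| = #|S| ^ 2.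
Proof.
set L := [set p | _]; pose sw (p : 'I_n * 'I_n) := (p.2, p.1).
have swI : injective sw by move=> [? ?] [? ?] [-> ->].
pose D := [set (x, x) | x in S].
have -> : #|S| ^ 2 = #|setX S S| by rewrite cardsX.
have -> : setX S S = (L :|: sw @: L) :|: D.
  apply/setP => -[x y]; rewrite !inE /=; apply/andP/idP => [[xS yS]|].
    have [lt|lt|/val_inj ->] := ltngtP x y; rewrite ?xS ?yS //=.
      by apply/orP; left; apply/imsetP; exists (y, x); rewrite ?inE /= ?xS ?yS.
    by apply/orP; right; apply/imsetP; exists y.
  case/orP=> [/orP[/and3P[]//|/imsetP[[u v]]]|/imsetP[u uS [-> ->]]//].
  by rewrite inE => /and3P[/= uS vS _] [-> ->].
have dis1 : [disjoint L & sw @: L].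
  apply/pred0P => p /=; apply/andP => -[+ /imsetP[[u v] + e]]; rewrite e !inE /=.
  by case/and3P=> _ _ vu /and3P[_ _ uv]; move: (ltn_trans uv vu); rewrite ltnn.
have dis2 : [disjoint L :|: sw @: L & D].
  apply/pred0P => p /=; apply/andP => -[+ /imsetP[u _ e]]; rewrite e !inE /= ltnn !andbF /=.
  by case/imsetP=> [[a b]]; rewrite inE /= => /and3P[_ _ ab] [e1 e2]; move: ab; rewrite -e1 -e2 ltnn.
rewrite !cardsU (disjoint_setI0 dis1) (disjoint_setI0 dis2) !cards0 !subn0 !card_imset //; last by move=> ? ? [].
by rewrite mul2n addnn.
Qed.

Lemma bin_leq_exp n k : 'C(n, k) <= n ^ k.
Proof.
rewrite (@leq_trans (n ^_ k)) //.
  by rewrite -bin_ffact leq_pmulr // fact_gt0.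
elim: k n => [|k IHk] [|n] //; rewrite ffactSS expnS leq_mul2l /=.
by apply: leq_trans (IHk n) _; case: k {IHk} => // k; rewrite leq_exp2r.
Qed.

Lemma no_triangle n (R : rel 'I_n) : symmetric R -> irreflexive R ->
  (forall x y z : 'I_n, x < y -> y < z -> R x y -> R y z -> R x z -> False) ->
  forall x y z, R x y -> R y z -> R x z -> False.
Proof.
move=> RS RI H.
have cmp x y : R x y -> (x < y) || (y < x).
  by move=> Rxy; rewrite -neq_ltn; apply/eqP => /val_inj e; rewrite e RI in Rxy.
have le (x y z : 'I_n) : x < y -> R x y -> R y z -> R x z -> False.
  move=> xy Rxy Ryz Rxz; have /orP[yz|zy] := cmp _ _ Ryz; first exact: (H x y z).
  have /orP[xz|zx] := cmp _ _ Rxz; first by apply: (H x z y); rewrite // RS.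
  by apply: (H z x y); rewrite // RS.
move=> x y z Rxy Ryz Rxz; have /orP[xy|yx] := cmp _ _ Rxy; first exact: (le x y z).
by apply: (le y x z); rewrite // RS.
Qed.

Section Packing.
Import ring lra.
Import Order.TTheory GRing.Theory Num.Theory.
Local Open Scope ring_scope.

(** With [y = 1 / N], Bernoulli's inequality gives [(1 + y) ^+ N >= 2], while
    [(1 - y) * (1 + y) <= 1]. *)
Lemma half_pow (N : nat) : (0 < N)%N -> (1 - N%:R^-1 : rat) ^+ N <= 2^-1.
Proof.
move=> N0; set y : rat := N%:R^-1.
have [y0 yN] : 0 < y /\ y * N%:R = 1 by rewrite invr_gt0 ltr0n mulVf ?pnatr_eq0 -?lt0n.
have y1 : y <= 1 by rewrite invf_le1 ?ltr0n // (ler_nat _ 1).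
have Bern M : 1 + y * M%:R <= (1 + y) ^+ M.
  elim: M => [|M IHM]; first by rewrite mulr0 addr0 expr0.
  have M0 : 0 <= y * M%:R by rewrite mulr_ge0 ?ler0n ?ltW.
  by rewrite exprS -natr1; nra.
have two : 2 <= (1 + y) ^+ N by have := Bern N; rewrite yN; lra.
have : ((1 - y) * (1 + y)) ^+ N <= 1 by rewrite exprn_ile1 //; nra.
have : 0 <= (1 - y) ^+ N by rewrite exprn_ge0; lra.
by rewrite exprMn; nra.
Qed.

(** [1 - 1 / q] is at most [(1 - 1 / (2 * q)) * (1 - 1 / (4 * q))]. The [m]-th power of the first
    factor is at most [1 / 2 ^ h] by [half_pow]; the second supplies the power of [1 - d] that the
    local lemma asks for. *)
Lemma miss_prob (q m h K : nat) : (48 <= q)%N -> (2 * q * h <= m)%N ->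
  (12 * q * K <= 2 ^ h)%N -> (0 < K)%N ->
  (q.-1)%:R ^+ m <= 1 / (12 * q%:R * K%:R) * (1 - 1 / (4 * q%:R)) ^+ m * q%:R ^+ m :> rat.
Proof.
move=> q48 hm hK K0; have q0 : (0 < q)%N by apply: leq_trans q48.
have : 48 <= q%:R :> rat by rewrite (ler_nat _ 48).
have pq : (q.-1)%:R = q%:R - 1 :> rat by rewrite -[in RHS](prednK q0) -natr1 addrK.
have hK' : 12 * q%:R * K%:R <= 2 ^+ h :> rat by rewrite -!natrM -natrX ler_nat.
have K0' : 0 < K%:R :> rat by rewrite ltr0n.
have q2 : (0 < 2 * q)%N by rewrite muln_gt0.
have tE : (2 * q)%:R^-1 = 1 / (2 * q%:R) :> rat by rewrite natrM div1r.
have := half_pow q2; rewrite {}tE {}pq.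
move: {q48 q0 hK K0 q2} (q%:R : rat) hK' K0' => Q hK K0 hp Q48.
set u := 1 - 1 / (2 * Q) in hp.
have Q0 : 0 < Q by lra.
have Qn : Q != 0 by lra.
have [t0 t1] : 0 <= 1 / (2 * Q) /\ 1 / (2 * Q) <= 1.
  by split; [rewrite divr_ge0; lra|rewrite ler_pdivrMr; lra].
have u0 : 0 <= u by rewrite /u; lra.
have u1 : u <= 1 by rewrite /u; lra.
have d0 : 0 <= 1 - 1 / (4 * Q).
  by have : 1 / (4 * Q) <= 1; [rewrite ler_pdivrMr; lra|lra].
have qu : Q - 1 <= u * (1 - 1 / (4 * Q)) * Q.
  have -> : u * (1 - 1 / (4 * Q)) * Q = Q - 3 / 4 + 1 / (8 * Q) by rewrite /u; field.
  by have : 0 <= 1 / (8 * Q); [rewrite divr_ge0; lra|lra].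
have um : u ^+ m <= 1 / (12 * Q * K%:R).
  apply: le_trans (_ : u ^+ (2 * q * h) <= _); first exact: ler_wiXn2l.
  rewrite exprM; apply: le_trans (_ : (2^-1) ^+ h <= _).
    by apply: lerXn2r; rewrite ?nnegrE ?exprn_ge0.
  have p1 : 0 < (2 : rat) ^+ h by rewrite exprn_gt0.
  have p2 : 0 < 12 * Q * K%:R by apply: mulr_gt0 K0; lra.
  by rewrite exprVn div1r (lef_pV2 p1 p2).
have pd : 0 <= u * (1 - 1 / (4 * Q)) * Q.
  by apply: mulr_ge0 (ltW Q0); apply: mulr_ge0 u0 d0.
apply: le_trans (_ : (u * (1 - 1 / (4 * Q)) * Q) ^+ m <= _).
  by apply: lerXn2r; rewrite ?nnegrE; [lra|exact: pd|exact: qu].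
have pm : 0 <= Q ^+ m by apply/exprn_ge0/ltW.
by rewrite !exprMn; apply: (ler_wpM2r pm); apply: (ler_wpM2r (exprn_ge0 m d0)).
Qed.

Let gt0_24 : 0 < 24 :> rat. Proof. by []. Qed.

Variables (r n k q h m : nat).
Hypotheses (q_gt0 : (0 < q)%N) (n_q : (72 * n <= q ^ 2)%N) (r_q : (48 * r <= q)%N).
Hypotheses (m_k : (2 * m + k = k ^ 2)%N) (h_m : (2 * q * h <= m)%N).
Hypotheses (n_gt0 : (0 < n)%N) (r_gt0 : (0 < r)%N) (h_n : (12 * q * n ^ k <= 2 ^ h)%N).

(** One coordinate for each pair and colour. [q] is the inverse edge probability, [k] the size of
    the sets to be hit, and [m] the number of pairs in such a set. *)
Let Var : finType := ('I_n * 'I_n * 'I_r)%type.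
(* Bad events: a triangle in one colour, an edge with two colours, a [k]-set missing
   a colour.  An edge gets colour [i] when its [i]-th coordinate is [zero], that is
   with probability [1 / q]; indices violating [ok] stand for the empty event. *)
Let Ev : finType := ('I_n * 'I_n * 'I_n * 'I_r + ('I_n * 'I_n * 'I_r * 'I_r + {set 'I_n} * 'I_r))%type.
Local Notation Om := {ffun Var -> 'I_q}.
Let zero : 'I_q := Ordinal q_gt0.

Let ok (e : Ev) := match e with
  | inl (x, y, z, _) => (x < y < z)%N
  | inr (inl (x, y, i, j)) => (x < y)%N && (i < j)%N
  | inr (inr (U, _)) => #|U| == k end.

Let vars (e : Ev) : {set Var} := match e with
  | inl (x, y, z, i) => [set (x, y, i); (y, z, i); (x, z, i)]
  | inr (inl (x, y, i, j)) => [set (x, y, i); (x, y, j)]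
  | inr (inr (U, i)) => [set v : Var | [&& v.1.1 \in U, v.1.2 \in U, (v.1.1 < v.1.2)%N & v.2 == i]]
  end.

Let vals (e : Ev) : {set 'I_q} := if e is inr (inr _) then [set~ zero] else [set zero].

Let bad (e : Ev) : {set {ffun Var -> 'I_q}} :=
  if ok e then [set w : Om | [forall v in vars e, w v \in vals e]] else set0.
Let supp (e : Ev) := if ok e then vars e else set0.

Let Q : rat := q%:R.
Let d : rat := 1 / (4 * Q).
(** The first two weights are twice the probabilities, the factor 2 absorbing the powers of [1 - d].
    Each of the three kinds of events then contributes at most [1 / (12 * Q)], a third of [d], at
    any variable. *)
Let wt (e : Ev) : rat := match e with
  | inl _ => 2 / Q ^+ 3
  | inr (inl _) => 2 / Q ^+ 2
  | inr (inr _) => 1 / (12 * Q * (n ^ k)%:R) end.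

Let q48 : (48 <= q)%N. Proof. lia. Qed.
Let Q48 : 48 <= Q. Proof. by rewrite /Q (ler_nat _ 48). Qed.

Let card_vars e : ok e -> #|vars e| = match e with
  | inl _ => 3 | inr (inl _) => 2 | _ => m end.
Proof.
case: e => [[[[x y] z] i]|[[[[x y] i] j]|[U i]]] /=.
- case/andP=> xy yz; rewrite setUC cardsU1 cards2 !inE !xpair_eqE !eqxx !andbT.
  by rewrite -!val_eqE /= (ltn_eqF xy) (gtn_eqF yz) ?andbF.
- by case/andP=> xy ij; rewrite cards2 !xpair_eqE !eqxx -val_eqE /= (ltn_eqF ij).
- move/eqP=> Uk; have := card_lt_pairs U; rewrite Uk.
  set L := [set p | _] => H; apply: etrans (_ : #|L| = m); last lia.
  clear H.
  rewrite -(card_imset (f := fun p => (p, i)) L); last by move=> ? ? [].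
  apply: eq_card => -[[x y] j]; rewrite !inE /=; apply/and4P/imsetP => [[xU yU xy /eqP ->]|[[u v] + [-> -> ->]]].
    by exists (x, y); [rewrite in_set /= xU yU xy|].
  by rewrite in_set => /and3P[]; split.
Qed.

Let bad_small e : #|bad e|%:R <= wt e * (1 - d) ^+ #|supp e| * #|Om|%:R.
Proof.
have Q0 : 0 < Q by have := Q48; lra.
have d0 : 0 <= d <= 1 / 192.
  by rewrite divr_ge0 ?ler_pdivrMr; have := Q48; lra.
have Bern (N : nat) : 1 - d *+ N <= (1 - d) ^+ N.
  have := @prod_oneminus_ge rat 'I_N predT (fun=> d); rewrite sumr_const prodr_const card_ord.
  by apply=> _; case/andP: d0 => ? ?; lra.
have Qn : Q != 0 by lra.
have wt0 : 0 <= wt e.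
  by case: e => [?|[?|?]] /=; rewrite divr_ge0 ?mulr_ge0 ?exprn_ge0 ?ler0n ?(ltW Q0).
rewrite /bad /supp; case: ifPn => oke; last by rewrite !cards0 expr0 mulr1 mulr_ge0 ?ler0n.
have card := card_ffun_in (vars e) (vals e).
have Qs : 0 < Q ^+ #|vars e| by rewrite exprn_gt0.
rewrite -(ler_pM2r Qs) -[X in X <= _](_ : (#|vals e| ^ #|vars e| * #|Om|)%:R = _); last first.
  by rewrite -card natrM natrX card_ord.
rewrite natrM mulrAC; apply: (ler_wpM2r (ler0n _ _)); rewrite natrX (card_vars oke).
case: e {wt0 card Qs} oke => [t|[t|[U i]]] oke; rewrite /vals /wt ?cards1 ?expr1n.
- rewrite (_ : _ * Q ^+ 3 = 2 * (1 - d) ^+ 3); last by field.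
  by have := Bern 3; rewrite mulrSr mulr2n; lra.
- rewrite (_ : _ * Q ^+ 2 = 2 * (1 - d) ^+ 2); last by field.
  by have := Bern 2; rewrite mulr2n; lra.
- by rewrite cardsC1 card_ord; apply: (miss_prob q48 h_m h_n); rewrite expn_gt0 n_gt0.
Qed.
Let card_triples v : (#|[pred t | v \in supp (inl t)]| <= 3 * n)%N.
Proof.
case: v => [[u w] i]; apply: (@leq_trans #|[set (u, w, z, i) | z : 'I_n] :|:
    [set (x, u, w, i) | x : 'I_n] :|: [set (u, y, w, i) | y : 'I_n]|).
  apply/subset_leq_card/subsetP => -[[[x y] z] j]; rewrite inE /supp /=.
  case: ifP => _; last by rewrite inE.
  rewrite !inE => /orP[/orP[]|] /eqP[-> -> ->].
  - by rewrite imset_f.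
  - by rewrite [X in _ || X || _]imset_f ?orbT.
  - by rewrite [X in _ || X]imset_f ?orbT.
rewrite 2!mulSn mul1n addnA; apply: leq_trans (leq_card_setU _ _) _.
apply: leq_add; last by apply: leq_trans (leq_imset_card _ _) _; rewrite card_ord.
apply: leq_trans (leq_card_setU _ _) _.
by apply: leq_add; apply: leq_trans (leq_imset_card _ _) _; rewrite card_ord.
Qed.

Let card_pairs v : (#|[pred t | v \in supp (inr (inl t))]| <= 2 * r)%N.
Proof.
case: v => [[u w] i]; apply: (@leq_trans #|[set (u, w, i, j) | j : 'I_r] :|:
    [set (u, w, j, i) | j : 'I_r]|).
  apply/subset_leq_card/subsetP => -[[[x y] a] b]; rewrite inE /supp /=.
  case: ifP => _; last by rewrite inE.
  rewrite !inE => /orP[] /eqP[-> -> ->].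
  - by rewrite imset_f.
  - by rewrite [X in _ || X]imset_f ?orbT.
rewrite mulSn mul1n; apply: leq_trans (leq_card_setU _ _) _.
by rewrite leq_add ?(leq_trans (leq_imset_card _ _)) ?card_ord.
Qed.

Let card_sets v : (#|[pred t | v \in supp (inr (inr t))]| <= n ^ k)%N.
Proof.
apply: leq_trans (bin_leq_exp n k); have := card_draws 'I_n k; rewrite card_ord => <-.
case: v => [[u w] i]; apply: leq_trans (leq_imset_card (fun U => (U, i)) _).
apply/subset_leq_card/subsetP => -[U j]; rewrite inE /supp /=.
case: ifP => [Uk|_]; last by rewrite inE.
by rewrite in_set => /and4P[_ _ _ /eqP /= ->]; apply: imset_f; rewrite in_set.
Qed.

Let Q0 : 0 < Q. Proof. by have := Q48; lra. Qed.
Let Qn : Q != 0. Proof. by have := Q48; lra. Qed.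

Let wt01 e : 0 <= wt e < 1.
Proof.
have Q1 : 1 <= Q by have := Q48; lra.
have Q3 : Q <= Q ^+ 3 by apply: ler_eXnr.
have Q2 : Q <= Q ^+ 2 by apply: ler_eXnr.
have K1 : 1 <= (n ^ k)%:R :> rat by rewrite (ler_nat _ 1) expn_gt0 n_gt0.
have QK : Q <= Q * (n ^ k)%:R by rewrite ler_peMr // ltW.
have := Q48; case: e => [t|[t|t]] Q48'; rewrite /wt -?mulrA; apply/andP; split.
- by rewrite divr_ge0; lra.
- by rewrite ltr_pdivrMr; lra.
- by rewrite divr_ge0; lra.
- by rewrite ltr_pdivrMr; lra.
- by rewrite divr_ge0; lra.
- by rewrite ltr_pdivrMr; lra.
Qed.

Let bad_var v : \sum_(e | v \in supp e) wt e <= d.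
Proof.
rewrite 2!big_sumType /= !sumr_const.
have b (y c B : rat) : 0 <= y -> c <= B -> y * B = 1 / (12 * Q) -> y * c <= 1 / (12 * Q).
  by move=> y0 cB <-; apply: ler_wpM2l.
have e1 : 2 / Q ^+ 3 *+ #|[pred t | v \in supp (inl t)]| <= 1 / (12 * Q).
  rewrite -mulr_natr; apply: (b _ _ (Q ^+ 2 / 24)); last by field.
    by case/andP: (wt01 (inl (Ordinal n_gt0, Ordinal n_gt0, Ordinal n_gt0, Ordinal r_gt0))).
  rewrite (ler_pdivlMr _ _ gt0_24) /Q -natrX -natrM ler_nat; apply: leq_trans n_q.
  by have := card_triples v; lia.
have e2 : 2 / Q ^+ 2 *+ #|[pred t | v \in supp (inr (inl t))]| <= 1 / (12 * Q).
  rewrite -mulr_natr; apply: (b _ _ (Q / 24)); last by field.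
    by case/andP: (wt01 (inr (inl (Ordinal n_gt0, Ordinal n_gt0, Ordinal r_gt0, Ordinal r_gt0)))).
  rewrite (ler_pdivlMr _ _ gt0_24) /Q -natrM ler_nat; apply: leq_trans r_q.
  by have := card_pairs v; lia.
have Kn : (n ^ k)%:R != 0 :> rat by rewrite pnatr_eq0 -lt0n expn_gt0 n_gt0.
have e3 : 1 / (12 * Q * (n ^ k)%:R) *+ #|[pred t | v \in supp (inr (inr t))]| <= 1 / (12 * Q).
  rewrite -mulr_natr; apply: (b _ _ (n ^ k)%:R); last by field; rewrite Qn.
    by case/andP: (wt01 (inr (inr (set0, Ordinal r_gt0)))).
  by rewrite ler_nat card_sets.
have -> : d = 1 / (12 * Q) + (1 / (12 * Q) + 1 / (12 * Q)) by rewrite /d; field.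
by apply: lerD e1 (lerD e2 e3).
Qed.

(** An outcome avoiding all bad events is read as a coloured graph: the triangle events make the
    colouring good, the two-colour events make [c] well defined, and the set events put every colour
    into every [k]-set. *)
Lemma triangle_free_packing : exists (E : rel 'I_n) (c : 'I_n -> 'I_n -> 'I_r),
  [/\ simple_graph E, good_col E c &
   forall (U : {set 'I_n}) i, #|U| = k -> exists x y, [/\ x \in U, y \in U, E x y & c x y = i]].
Proof.
have A_dep e (w w' : Om) : {in supp e, w =1 w'} -> (w \in bad e) = (w' \in bad e).
  rewrite /supp /bad; case: ifP => _ ww'; last by rewrite !inE.
  by rewrite !inE; apply: eq_forallb_in => v /ww' ->.
have Om0 : (0 < #|Om|)%N by rewrite card_ffun expn_gt0 card_ord q_gt0.
have d01 : 0 <= d <= 1.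
  by apply/andP; split; [rewrite divr_ge0|rewrite ler_pdivrMr]; have := Q48; lra.
have [w avoids] := local_lemma A_dep Om0 wt01 d01 bad_var bad_small.
pose pres (x y : 'I_n) (i : 'I_r) := (x < y)%N && (w (x, y, i) == zero).
pose pr x y i := pres x y i || pres y x i.
have prS x y i : pr x y i = pr y x i by rewrite /pr orbC.
have pr_lt (x y : 'I_n) (i : 'I_r) : (x < y)%N -> pr x y i -> w (x, y, i) = zero.
  by move=> xy; rewrite /pr /pres xy [(y < x)%N]ltnNge (ltnW xy) orbF => /eqP.
have uniq_ij x y (i j : 'I_r) : pr x y i -> pr x y j -> i = j.
  wlog xy : x y / (x < y)%N => [th|].
    have [/th//|yx|/val_inj ->] := ltngtP x y; last by rewrite /pr /pres ltnn.
    by rewrite (prS x y i) (prS x y j); apply: th.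
  wlog ij : i j / (i < j)%N => [th pi pj|].
    have [/th|/th ji|/val_inj //] := ltngtP i j; first by apply.
    by apply/esym/ji.
  move=> /(pr_lt _ _ _ xy) wi /(pr_lt _ _ _ xy) wj.
  have /negP[] := avoids (inr (inl (x, y, i, j))); rewrite /bad /= xy ij /= inE.
  by apply/forall_inP => v; rewrite !inE => /orP[]/eqP ->; rewrite ?wi ?wj.
have notri (x y z : 'I_n) (i : 'I_r) : (x < y)%N -> (y < z)%N -> pr x y i -> pr y z i -> pr x z i -> False.
  move=> xy yz /(pr_lt _ _ _ xy) w1 /(pr_lt _ _ _ yz) w2 /(pr_lt _ _ _ (ltn_trans xy yz)) w3.
  have /negP[] := avoids (inl (x, y, z, i)); rewrite /bad /= xy yz /= inE.
  by apply/forall_inP => v; rewrite !inE => /orP[/orP[]|]/eqP ->; rewrite ?w1 ?w2 ?w3.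
pose E x y := [exists i, pr x y i].
pose c x y := odflt (Ordinal r_gt0) [pick i | pr x y i].
have cP x y i : pr x y i -> c x y = i.
  move=> pi; rewrite /c; case: pickP => [j pj|/(_ i)]; last by rewrite pi.
  exact: uniq_ij pj pi.
have Ec x y : E x y -> pr x y (c x y) by case/existsP=> i pi; rewrite (cP _ _ i).
have EI x : E x x = false by apply/existsP => -[i]; rewrite /pr /pres ltnn.
exists E, c; split.
- by split=> [x y|x]; [apply: eq_existsb => i; apply: prS|exact: EI].
- split=> [x y|x y z /Ec xy /Ec yz /Ec xz e1 e2].
    by rewrite /c; congr odflt; apply: eq_pick => i; apply: prS.
  move: xy yz xz; rewrite -e2 -e1; move: (c x y) => i.
  apply: (@no_triangle _ (fun u v => pr u v i)) => [u v|u|u v w'].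
  + exact: prS.
  + by rewrite /pr /pres ltnn.
  + by move=> uv vw; apply: notri.
- move=> U i Uk; have := avoids (inr (inr (U, i))); rewrite /bad /= Uk eqxx inE.
  case/forall_inPn=> -[[x y] j]; rewrite !inE /= => /and4P[xU yU xy /eqP ->].
  rewrite negbK => w0; have pxy : pr x y i by rewrite /pr /pres xy w0.
  by exists x, y; split; [exact: xU|exact: yU|apply/existsP; exists i|exact: cP].
Qed.
End Packing.

Section PackingParameters.
Import ring.

(** Here [l] bounds the binary logarithm of [r], and [n = r * k]. Every map to [r] colours thus has
    a class of at least [k] vertices, and the packing puts an edge of the class's own colour inside
    it. *)
Lemma star_blocking_exists D r l : 4 * 768 <= D -> D <= 2 ^ 13 -> 0 < r -> 0 < l -> r <= 2 ^ l ->
  exists (E : rel 'I_(r * (D * (D * r * l ^ 2)))) (c : _ -> _ -> 'I_r),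
    [/\ simple_graph E, good_col E c & star_blocking E c].
Proof.
move=> Dge Dle r0 l0 rl; set X := D * r * l ^ 2; set k := D * X; set n := r * k.
have D0 : 0 < D by apply: leq_trans Dge.
have X0 : 0 < X by rewrite !muln_gt0 D0 r0 ?expn_gt0 l0.
have DX : D * 1 <= D * X by rewrite leq_mul2l X0 orbT.
have k12 : 12 <= k by apply: leq_trans DX; rewrite muln1; apply: leq_trans Dge.
(* [q] makes [q ^ 2] equal to [144 * n]. The exponent [h] is [30 * l * k] for [n ^ k] plus
   [2 * l * k] for [12 * q]. The lower bound on [D] is what [h_m] needs, as [4 * (2 * q * h)] equals
   [4 * 768 * (X * k)]. *)
pose q := 12 * (D * (r * l)); pose h := 32 * (l * k).
have q0 : 0 < q by rewrite !muln_gt0 D0 r0 l0.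
have n0 : 0 < n by rewrite muln_gt0 r0 (leq_trans _ k12).
have n_q : 72 * n <= q ^ 2.
  have -> : q ^ 2 = 144 * n by rewrite /q /n /k /X; ring.
  by rewrite leq_mul2r orbC.
have r_q : 48 * r <= q.
  have -> : q = 12 * D * l * r by rewrite /q; ring.
  rewrite leq_mul2r; apply/orP; right; rewrite -[48]/(12 * 4 * 1).
  by rewrite !leq_mul // (leq_trans _ Dge).
have k2 : k <= k ^ 2 by rewrite -mulnn leq_pmull // (leq_trans _ k12).
have m_k : 2 * 'C(k, 2) + k = k ^ 2.
  rewrite bin2 mul2n -[RHS]mulnn; have : ~~ odd (k * k.-1) by case: (k) => // j; rewrite oddM /= andNb.
  by move/even_halfK => ->; case: (k) k12 => // j _; rewrite -mulnSr.
have h_m : 2 * q * h <= 'C(k, 2).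
  have e : 4 * (2 * q * h) <= k ^ 2.
    have -> : 4 * (2 * q * h) = (4 * 768) * (X * k) by rewrite /q /h /X; ring.
    by rewrite -mulnn mulnA leq_mul2r /k leq_mul2r Dge !orbT.
  have : 2 * k <= k ^ 2 by rewrite -mulnn leq_mul2r (leq_trans _ k12) ?orbT.
  by clear -e m_k; lia.
have h_n : 12 * q * n ^ k <= 2 ^ h.
  have l2 : l <= 2 ^ l by rewrite ltnW // ltn_expl.
  have nl : n <= 2 ^ (30 * l).
    have -> : n = D * D * (r * r * (l * l)) by rewrite /n /k /X; ring.
    apply: (@leq_trans (2 ^ 13 * 2 ^ 13 * (2 ^ l * 2 ^ l * (2 ^ l * 2 ^ l)))).
      by rewrite !leq_mul.
    by rewrite -!expnD leq_exp2l //; clear -l0; lia.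
  have ql : 12 * q <= 2 ^ (2 * l * k).
    have -> : 12 * q = 144 * (D * (r * l)) by rewrite /q; ring.
    apply: (@leq_trans (2 ^ 8 * (2 ^ 13 * (2 ^ l * 2 ^ l)))); first by rewrite !leq_mul.
    rewrite -!expnD leq_exp2l //; apply: (@leq_trans (2 * l * 12)); last by rewrite leq_mul2l k12 orbT.
    by clear -l0; lia.
  have nk : n ^ k <= 2 ^ (30 * l * k) by rewrite expnM leq_exp2r // (leq_trans _ k12).
  apply: leq_trans (leq_mul ql nk) _; rewrite -expnD leq_exp2l // /h.
  by clear; lia.
have [E [c [sE cG EU]]] := triangle_free_packing q0 n_q r_q m_k h_m n0 r0 h_n.
exists E, c; split=> // g.
(* As [n = r * k] exceeds [r * k.-1], some class has more than [k.-1] elements; exactly [k] of them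
   are kept. *)
have [|i] := @pigeonhole r k.-1 _ [set: 'I_n] g.
  by rewrite cardsT card_ord ltn_pmul2l // prednK // (leq_trans _ k12).
rewrite prednK ?(leq_trans _ k12) // => /card_geqP[s [us sk sU]].
have [|x [y [xs ys Exy cxy]]] := EU [set x in s] i; first by rewrite cardsE (card_uniqP us).
exists x, y; rewrite !inE in xs ys; have := sU x xs; have := sU y ys.
by rewrite !inE cxy => /eqP gy /eqP gx.
Qed.
End PackingParameters.

(** * Independent sets in triangle-free graphs *)

(** A subset and its complement in [X] together have [#|X|] elements. *)
Lemma sum_card_powerset (T : finType) (X : {set T}) :
  2 * (\sum_(Y in powerset X) #|Y|) = #|X| * 2 ^ #|X|.
Proof.
rewrite mul2n -addnn {2}(reindex_onto (fun Y => X :\: Y) (fun Y => X :\: Y)) /=; last first.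
  by move=> Y; rewrite powersetE => /setIidPr YX; rewrite setDDr setDv set0U.
rewrite [X in _ + X](eq_bigl (mem (powerset X))); last first.
  move=> Y; rewrite !powersetE subsetDl setDDr setDv set0U /=.
  by rewrite inE; apply/eqP/idP => [<-|/setIidPr]; first exact: subsetIl.
rewrite -big_split /= (eq_bigr (fun=> #|X|)).
  by rewrite sum_nat_const card_powerset mulnC.
by move=> Y; rewrite powersetE => YX; rewrite cardsD (setIidPr YX) subnKC // subset_leq_card.
Qed.

(** With [x] allowed neighbours there are [2 ^ x + 1] continuations, on which [D] for choosing [v]
    plus the number of chosen neighbours averages at least [L / 3]. For [x <= L] there are few
    continuations and the term [D] suffices; for larger [x] the neighbours do. *)
Lemma log_average L D x : 4 ^ L <= D -> 2 * L * (2 ^ x + 1) <= 6 * D + 3 * (x * 2 ^ x).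
Proof.
move=> LD; have [xL|Lx] := leqP x L.
  have e1 : 2 ^ x <= 2 ^ L by rewrite leq_exp2l.
  have e2 : L <= 2 ^ L by rewrite ltnW // ltn_expl.
  have e3 : 2 ^ L * 2 ^ L = 4 ^ L by rewrite -expnMn.
  have e4 : 1 <= 2 ^ L by rewrite expn_gt0.
  have e5 : L * (2 ^ x + 1) <= 2 ^ L * (2 ^ L + 2 ^ L) by rewrite leq_mul // leq_add.
  by move: (3 * _) => z; lia.
have e1 : 2 <= 2 ^ x by rewrite -[2]/(2 ^ 1) leq_exp2l // (leq_ltn_trans _ Lx).
have e2 : L * 2 ^ x <= x * 2 ^ x by rewrite leq_mul2r ltnW ?orbT.
have e3 : L * 2 <= L * 2 ^ x by rewrite leq_mul2l e1 orbT.
by rewrite mulnDr muln1 -mulnA; move: (L * 2 ^ x) (x * 2 ^ x) e2 e3 => a b; lia.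
Qed.

Section IndepSet.
Import ring.
Variables (V : finType) (E : rel V) (U : {set V}) (D L : nat).
Hypotheses (ES : symmetric E) (EI : irreflexive E).
Hypothesis tri : forall x y z, x \in U -> y \in U -> z \in U -> E x y -> E y z -> E x z -> False.
Let N v := [set y in U | E v y].
Hypothesis deg : forall v, v \in U -> #|N v| <= D.
Hypothesis LD : 4 ^ L <= D.

Let Ind := [set W : {set V} | (W \subset U) && [forall x in W, forall y in W, ~~ E x y]].

Let IndP (W : {set V}) : reflect (W \subset U /\ {in W &, forall x y, ~~ E x y}) (W \in Ind).
Proof.
rewrite inE; apply: (iffP andP) => -[WU] H; split=> //.
  by move=> x y xW yW; have /forall_inP/(_ x xW)/forall_inP/(_ y yW) := H.
by apply/forall_inP => x xW; apply/forall_inP => y yW; apply: H.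
Qed.

(* Conditionally on [W] outside [v] and its neighbours, either [W] continues with [v],
   or with an arbitrary subset of the [x] neighbours still allowed. *)
Let local_average v : v \in U ->
  L * #|Ind| <= 3 * \sum_(W in Ind) (D * (v \in W) + #|W :&: N v|).
Proof.
move=> vU; pose g W : {set V} := W :\: (v |: N v).
rewrite -sum1_card (partition_big g (mem [set g W | W in Ind])) /=; last by move=> W; apply: imset_f.
rewrite [in X in _ <= X](partition_big g (mem [set g W | W in Ind])) /=; last by move=> W; apply: imset_f.
rewrite !big_distrr /=; apply: leq_sum => S /imsetP[W0 /IndP[W0U W0I] eS].
have SU : S \subset U by rewrite eS; apply: subset_trans W0U; apply: subsetDl.
have SI : {in S &, forall x y, ~~ E x y}.
  by move=> x y; rewrite eS !inE => /andP[_ xW] /andP[_ yW]; apply: W0I.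
have Sv x : x \in S -> [/\ x != v, x \in U, ~~ E v x & x \notin N v].
  move=> xS; have xU := subsetP SU x xS; move: xS; rewrite eS !inE xU negb_or /=.
  by case/andP=> /andP[-> ->].
pose X := [set y in N v | [forall x in S, ~~ E x y]].
have XP y : y \in X -> [/\ y \in U, E v y & forall x, x \in S -> ~~ E x y].
  by rewrite !inE => /andP[/andP[-> ->] /forall_inP].
have vN : v \notin N v by rewrite inE EI andbF.
pose C := (v |: S) |: [set S :|: Y | Y in powerset X].
have CE : [set W in Ind | g W == S] = C.
  apply/setP => W; rewrite in_set in_setU1; apply/andP/orP.
    case=> /IndP[WU WI] /eqP gW; have [vW|vW] := boolP (v \in W).
      left; apply/eqP/setP => x; rewrite -gW !inE; have [->//|xv] := eqVneq x v.
      have [xW|] := boolP (x \in W); last by rewrite andbF.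
      by rewrite (negPf (WI v x vW xW)) andbF.
    right; apply/imsetP; exists (W :&: N v).
      rewrite powersetE; apply/subsetP => y /setIP[yW yN]; rewrite inE yN.
      apply/forall_inP => x; rewrite -gW inE => /andP[_ xW]; exact: WI.
    apply/setP => x; rewrite -gW !inE; have [xW|] := boolP (x \in W); last by rewrite andbF.
    have -> : (x == v) = false by apply/eqP => xv; rewrite -xv xW in vW.
    by rewrite andbT /=; case: (_ && _).
  have gS (Y : {set V}) : Y \subset v |: N v -> g (Y :|: S) = S.
    move=> /subsetP YN; apply/setP => x; rewrite in_setD [x \in Y :|: S]in_setU.
    have [xS|xS] := boolP (x \in S).
      by have [xv _ _ xN] := Sv x xS; rewrite orbT andbT in_setU1 negb_or xv xN.
    by rewrite orbF; apply/negP => /andP[/negP xN /YN].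
  have ind1 : v |: S \in Ind.
    apply/IndP; split; first by rewrite subUset sub1set vU.
    move=> x y; rewrite !in_setU1 => /orP[/eqP ->|xS] /orP[/eqP ->|yS]; rewrite ?EI //.
    - by case: (Sv y yS).
    - by rewrite ES; case: (Sv x xS).
    - exact: SI.
  case=> [/eqP ->|/imsetP[Y + ->]]; first by rewrite ind1 gS // sub1set setU11.
  rewrite powersetE => /subsetP YX; split; last first.
    rewrite setUC gS //; apply/subsetP => y /YX; rewrite inE => /andP[yN _].
    by rewrite in_setU1 yN orbT.
  apply/IndP; split; first by rewrite subUset SU; apply/subsetP => y /YX/XP[].
  move=> x y; rewrite !in_setU => /orP[xS|/YX/XP[xU vx xS]] /orP[yS|/YX/XP[yU vy yS]].
  - exact: SI.
  - exact: yS.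
  - by rewrite ES; apply: xS.
  - by apply/negP => xy; apply: (tri vU xU yU).
have SX Y : Y \in powerset X -> [disjoint S & Y].
  rewrite powersetE => /subsetP YX; apply/pred0P => x /=; apply/negP => /andP[/Sv[_ _ _ xN] /YX].
  by rewrite inE (negPf xN).
have Uinj : {in powerset X &, injective (fun Y => S :|: Y)}.
  move=> Y Y' /SX SY /SX SY' e; rewrite -[Y](setU0) -[Y'](setU0).
  have D0 (Z : {set V}) : [disjoint S & Z] -> (S :|: Z) :\: S = Z.
    by move=> d; rewrite setDUl setDv set0U; apply/setDidPl; rewrite disjoint_sym.
  by rewrite !setU0 -(D0 _ SY) e D0.
have vC : v |: S \notin [set S :|: Y | Y in powerset X].
  apply/negP => /imsetP[Y]; rewrite powersetE => /subsetP YX /setP/(_ v).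
  rewrite setU11 in_setU => /esym/orP[/Sv[]|/YX/XP[_]]; first by rewrite eqxx.
  by rewrite EI.
have sumC F : \sum_(W in Ind | g W == S) F W = F (v |: S) + \sum_(Y in powerset X) F (S :|: Y).
  rewrite (eq_bigl (mem C)); last by move=> W; rewrite -CE !inE.
  by rewrite /= big_setU1 // big_imset.
rewrite !sumC sum1_card card_powerset.
have e1 : D <= D * (v \in v |: S) + #|(v |: S) :&: N v|.
  by rewrite setU11 muln1 leq_addr.
have e2 : \sum_(Y in powerset X) #|Y| <=
    \sum_(Y in powerset X) (D * (v \in S :|: Y) + #|(S :|: Y) :&: N v|).
  apply: leq_sum => Y; rewrite powersetE => /subsetP YX; apply: leq_trans (leq_addl _ _).
  apply/subset_leq_card/subsetP => y yY; rewrite in_setI in_setU yY orbT /=.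
  by have := YX y yY; rewrite inE => /andP[].
have := log_average #|X| LD; have := sum_card_powerset X.
move: (2 ^ #|X|) e1 e2 => p; clear; move: (\sum_(_ in _) _) (\sum_(_ in _) _) => s1 s2.
move: (D * _ + _) => t; nia.
Qed.

(** Summed over [v], the bound of [local_average] counts each independent [W] at most [2 * D * #|W|]
    times: [D] for each member and at most [D] for the edges at it. Some [W] reaches the average,
    with constant [6 = 3 * 2]. *)
Lemma indep_exists : exists W : {set V},
  [/\ W \subset U, {in W &, forall x y, ~~ E x y} & L * #|U| <= 6 * D * #|W|].
Proof.
have [[W]|no] := classic (exists W, W \in Ind /\ L * #|U| <= 6 * D * #|W|).
  by case=> /IndP[WU WI] le; exists W.
have I0 : 0 < #|Ind|.
  by apply/card_gt0P; exists set0; apply/IndP; split; [apply: sub0set|move=> x y; rewrite inE].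
have lt : \sum_(W in Ind) 6 * D * #|W| < L * #|U| * #|Ind|.
  have -> : L * #|U| * #|Ind| = \sum_(W in Ind) L * #|U| by rewrite sum_nat_const mulnC.
  apply: (@leq_trans (\sum_(W in Ind) (6 * D * #|W| + 1))).
    by rewrite big_split /= sum1_card -addn1 leq_add2l.
  by apply: leq_sum => W WI; rewrite addn1 ltnNge; apply/negP => le; apply: no; exists W.
suff : L * #|U| * #|Ind| <= \sum_(W in Ind) 6 * D * #|W| by rewrite leqNgt lt.
have : \sum_(v in U) L * #|Ind| <= \sum_(v in U) 3 * \sum_(W in Ind) (D * (v \in W) + #|W :&: N v|).
  by apply: leq_sum => v; apply: local_average.
rewrite sum_nat_const -big_distrr exchange_big /= => le.
rewrite (_ : L * #|U| * _ = #|U| * (L * #|Ind|)); last ring.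
apply: leq_trans le _; rewrite big_distrr /=; apply: leq_sum => W /IndP[WU WI].
have e1 : \sum_(v in U) D * (v \in W) = D * #|W|.
  rewrite -big_distrr /= -sum1_card; congr (_ * _).
  rewrite [RHS](big_setID U) /= [X in _ + X]big1 ?addn0; last first.
    by move=> v /setDP[vW]; rewrite (subsetP WU).
  by rewrite -big_mkcondr /=; apply: eq_bigl => v; rewrite inE andbC.
have e2 : \sum_(v in U) #|W :&: N v| <= #|W| * D.
  rewrite -sum_nat_const.
  have -> : \sum_(v in U) #|W :&: N v| = \sum_(v in U) \sum_(w in W) (E v w).
    apply: eq_bigr => v vU; rewrite -sum1_card big_mkcond [RHS]big_mkcond /=; apply: eq_bigr => w _.
    by rewrite !inE; case: (boolP (w \in W)) => //= /(subsetP WU) ->; case: (E v w).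
  rewrite exchange_big /=; apply: leq_sum => w wW; apply: leq_trans (deg (subsetP WU w wW)).
  rewrite -sum1_card big_mkcond [X in _ <= X]big_mkcond /=; apply: leq_sum => v _.
  by rewrite inE ES; case: (v \in U) => //=; case: (E w v).
by rewrite big_split /= e1; move: (#|W|) e2 => w; clear; nia.
Qed.
End IndepSet.

(** * The greedy colouring of a neighbourhood *)

(** By minimality the graph without [v] has a good colouring [c]. A map [f] without such [x] and [y]
    would extend [c] to [v]. *)
Lemma minimal_blocking r (V : finType) (E : rel V) (v : V) :
  0 < r -> ramsey_minimal_K3 r E ->
  exists2 c : V -> V -> 'I_r, good_col (fun x y => [&& E x y, x != v & y != v]) c &
    forall f : V -> 'I_r, exists x y, [/\ E v x, E v y, E x y, f x = f y & c x y = f x].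
Proof.
move=> r0 [[ES EI] [RE min]]; pose F : rel V := fun x y => [&& E x y, x != v & y != v].
pose A : {set V} := ~: [set v].
have AE x : (x \in A) = (x != v) by rewrite !inE.
have FS : symmetric F by move=> x y; rewrite /F ES; congr andb; apply: andbC.
have /not_ramseyE[c0 c0G] : ~ ramsey_K3 r (sub_rel A F).
  apply: min; split; first by split=> // x y; rewrite !AE.
  by left; apply/eqP => /setP/(_ v); rewrite AE eqxx inE.
pose c x y : 'I_r := if (insub x, insub y) is (Some x', Some y') then c0 x' y' else Ordinal r0.
have cG : good_col F c.
  split=> [x y|x y z].
    by rewrite /c; case: (insub x) (insub y) => [x'|] [y'|] //; apply: c0G.1.
  move=> Fxy Fyz Fxz; move: (Fxy) (Fyz) => /and3P[_ xv yv] /and3P[_ _ zv].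
  rewrite -AE in xv; rewrite -AE in yv; rewrite -AE in zv.
  rewrite /c (insubT (mem A) xv) (insubT (mem A) yv) (insubT (mem A) zv).
  exact: c0G.2.
exists c => // f; apply: NNPP => no.
pose c' x y := if x == v then f y else if y == v then f x else c x y.
have vv x : E v x -> x != v by move=> vx; apply/eqP => e; rewrite e EI in vx.
have c'G : good_col E c'.
  split=> [x y|x y z].
    rewrite /c'; case: (eqVneq x v) => [xv|xv]; case: (eqVneq y v) => [yv|yv] //.
      by rewrite xv yv.
    exact: cG.1.
  rewrite /c' => Exy Eyz Exz; have [xv|xv] := eqVneq x v.
    rewrite xv in Exy Exz; rewrite (negPf (vv _ Exy)) (negPf (vv _ Exz)) => e1 e2.
    by apply: no; exists y, z; rewrite -e2 -e1.
  have [yv|yv] := eqVneq y v.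
    rewrite yv in Exy Eyz; rewrite ES in Exy; rewrite (negPf (vv _ Eyz)) => e1 e2.
    by apply: no; exists x, z; rewrite -e2.
  have [zv|zv] := eqVneq z v.
    rewrite zv in Exz Eyz; rewrite ES in Exz; rewrite ES in Eyz => e1 e2.
    by apply: no; exists x, y; rewrite -e1 -e2.
  by apply: cG.2; rewrite /F ?Exy ?Eyz ?Exz ?xv ?yv ?zv.
by have [x [y [z /and5P[xy yz xz /eqP e1 /eqP e2]]]] := RE c' c'G.1; apply: (c'G.2 x y z).
Qed.

Lemma leq_cardsD1 (T : finType) (K : {set T}) i n : n < #|K| -> n <= #|K :\ i|.
Proof. by rewrite (cardsD1 i K); case: (i \in K) => //=; rewrite add0n => /ltnW. Qed.

Section Greedy.
Import ring.
Variables (r : nat) (V : finType) (E : rel V) (c : V -> V -> 'I_r).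
Hypotheses (ES : symmetric E) (EI : irreflexive E) (cG : good_col E c).

(** [f] colours the edges from a deleted vertex to [U], with palette [K], without closing a
    monochromatic triangle. *)
Definition colourable (K : {set 'I_r}) (U : {set V}) := exists2 f : V -> 'I_r,
  {in U, forall x, f x \in K} &
  forall x y, x \in U -> y \in U -> E x y -> f x = f y -> c x y <> f x.

Definition all_colourable k m := forall (K : {set 'I_r}) (U : {set V}),
  k <= #|K| -> #|U| <= m -> colourable K U.

Lemma colourable_step (K : {set 'I_r}) (U W : {set V}) i : i \in K ->
  {in W &, forall x y, E x y -> c x y != i} -> colourable (K :\ i) (U :\: W) -> colourable K U.
Proof.
move=> iK Wi [f fK fc]; exists (fun x => if x \in W then i else f x).
  move=> x xU; case: ifPn => // xW.
  by have := fK x; rewrite !inE xW xU => /(_ isT)/andP[].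
move=> x y xU yU Exy; case: ifPn => xW; case: ifPn => yW.
- by move=> _ /eqP; apply/negP/Wi.
- by move=> e; have := fK y; rewrite !inE yW yU -e eqxx => /(_ isT).
- by move=> e; have := fK x; rewrite !inE xW xU e eqxx => /(_ isT).
- by apply: fc; rewrite // inE ?xW ?yW.
Qed.

Lemma all_colourable_single : all_colourable 1 1.
Proof.
move=> K U /card_gt0P[i iK] Uk; exists (fun=> i) => // x y xU yU Exy.
suff e : x = y by rewrite e EI in Exy.
by move/card_le1_eqP: Uk; apply.
Qed.

(** Two vertices can share any colour except that of the edge between them, so each further colour
    disposes of two vertices. *)
Lemma all_colourable_pairs k : all_colourable k.+1 (2 * k).+1.
Proof.
elim: k => [|k IHk] K U kK Uk; first exact: all_colourable_single kK Uk.
have [U1|/card_gt1P[x [y [xU yU xy]]]] := leqP #|U| 1.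
  exact: all_colourable_single (leq_trans _ kK) U1.
have [i iK ic] : exists2 i, i \in K & c x y != i.
  have /card_gt0P[i] : 0 < #|K :\ c x y| by apply: leq_trans (leq_cardsD1 _ kK).
  by rewrite !inE => /andP[ic iK]; exists i; rewrite // eq_sym.
apply: (colourable_step (W := [set x; y]) iK).
  move=> u w; rewrite !inE => /orP[]/eqP -> /orP[]/eqP ->; rewrite ?EI // => _.
  by rewrite cG.1.
have WU : [set x; y] \subset U by rewrite subUset !sub1set xU.
apply: IHk; first exact: leq_cardsD1.
by rewrite cardsD (setIidPr WU) cards2 xy; lia.
Qed.

(** Each ordered pair has one colour, so the edge counts of the colours in [K] sum to at most
    [#|U| ^ 2], and one of them is at most the average. *)
Lemma sparse_colour (K : {set 'I_r}) (U : {set V}) : 0 < #|K| -> exists2 i, i \in K &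
  #|K| * (\sum_(x in U) #|[set y in U | E x y && (c x y == i)]|) <= #|U| ^ 2.
Proof.
move=> K0; pose e i := \sum_(x in U) #|[set y in U | E x y && (c x y == i)]|.
have [//|no] := classic (exists2 i, i \in K & #|K| * e i <= #|U| ^ 2).
have tot : \sum_(i in K) e i <= #|U| ^ 2.
  rewrite exchange_big /= -mulnn -sum_nat_const; apply: leq_sum => x _.
  rewrite -[leqRHS]sum1_card (eq_bigr (fun i => \sum_(y in U) (E x y && (c x y == i)))); last first.
    by move=> i _; rewrite -sum1_card big_mkcond [RHS]big_mkcond; apply: eq_bigr => y _; rewrite inE; case: (y \in U) (E x y) (c x y == i) => [] [] [].
  rewrite exchange_big /=; apply: leq_sum => y _.
  rewrite (leq_trans (n := \sum_(i in K) (i == c x y))) //.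
    by apply: leq_sum => i _; rewrite eq_sym; case: (E x y); case: (_ == _).
  rewrite big_mkcond /= (bigD1 (c x y)) //= big1 ?addn0; first by case: (_ \in K); rewrite ?eqxx.
  by move=> i /negPf ->; case: (_ \in K).
have : \sum_(i in K) (#|U| ^ 2).+1 <= \sum_(i in K) #|K| * e i.
  by apply: leq_sum => i iK; rewrite ltnNge; apply/negP => le; apply: no; exists i.
rewrite sum_nat_const -big_distrr leq_pmul2l //= => le.
by move: (leq_trans le tot); rewrite ltnn.
Qed.

(** In a sparse colour, the vertices of degree above twice the bound on the average are dropped; at
    least half of [U] remains, and [indep_exists] applies. In [24 = 6 * 2 * 2] the factors come from
    that lemma, the degree bound and the halving. *)
Lemma big_indep (K : {set 'I_r}) (U : {set V}) L : 0 < #|K| -> 4 ^ L * #|K| <= 2 * #|U| ->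
  exists i (W : {set V}), [/\ i \in K, W \subset U, {in W &, forall x y, E x y -> c x y != i} &
    L * #|K| <= 24 * #|W|].
Proof.
move=> K0 LK; have [i iK ei] := sparse_colour U K0.
pose R x y := E x y && (c x y == i); pose N (U' : {set V}) x := [set y in U' | R x y].
pose D := 2 * #|U| %/ #|K|; pose U' := [set x in U | #|N U x| <= D].
have U'U : U' \subset U by apply/subsetP => x; rewrite inE => /andP[].
have LD : 4 ^ L <= D by rewrite leq_divRL.
have U0 : 0 < #|U|.
  rewrite lt0n; apply/eqP => U0; move: LK; rewrite U0 muln0 leqNgt muln_gt0 K0.
  by rewrite expn_gt0.
have DK : D * #|K| <= 2 * #|U| by apply: leq_divM.
have half : #|U| <= 2 * #|U'|.
  have e1 : \sum_(x in U :\: U') (2 * #|U|) <= #|U| ^ 2.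
    apply: leq_trans ei; rewrite big_distrr /= [X in _ <= X](big_setID U') /=.
    apply: leq_trans (leq_addl _ _); apply: leq_sum => x; rewrite !inE.
    case/andP=> + xU; rewrite xU /= -ltnNge => lt.
    by rewrite [X in _ <= X]mulnC; apply: ltnW; rewrite -ltn_divLR.
  rewrite sum_nat_const mulnA -mulnn leq_pmul2r // cardsD (setIidPr U'U) in e1.
  by move: e1 (subset_leq_card U'U); move: #|U| #|U'| => a b; lia.
have [|||||W [WU WI Wc]] := @indep_exists V R U' D L.
- by move=> x y; rewrite /R ES cG.1.
- by move=> x; rewrite /R EI.
- move=> x y z _ _ _ /andP[xy /eqP e1] /andP[yz /eqP e2] /andP[xz /eqP e3].
  by apply: (cG.2 x y z); rewrite // ?e1 ?e2 ?e3.
- move=> x; rewrite inE => /andP[xU]; apply: leq_trans; apply/subset_leq_card/subsetP => y.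
  by rewrite !inE => /andP[/andP[-> _] ->].
- exact: LD.
exists i, W; split=> //; first exact: subset_trans U'U.
  by move=> x y xW yW Exy; have := WI x y xW yW; rewrite /R Exy.
rewrite -(leq_pmul2l U0).
apply: (@leq_trans (2 * #|U'| * (L * #|K|))); first by rewrite leq_mul2r half orbT.
have -> : 2 * #|U'| * (L * #|K|) = 2 * #|K| * (L * #|U'|) by ring.
apply: (@leq_trans (2 * #|K| * (6 * D * #|W|))); first by rewrite leq_mul2l Wc orbT.
have -> : 2 * #|K| * (6 * D * #|W|) = D * #|K| * (12 * #|W|) by ring.
apply: (@leq_trans (2 * #|U| * (12 * #|W|))); first by rewrite leq_mul2r DK orbT.
by apply: eq_leq; ring.
Qed.

Lemma all_colourable_trivial k : all_colourable k.+1 0.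
Proof.
move=> K U kK; rewrite leqn0 cards_eq0 => /eqP ->.
have /card_gt0P[i iK] : 0 < #|K| by apply: leq_trans kK.
by exists (fun=> i) => // x; rewrite inE.
Qed.

(** The end of the greedy process, without logarithmic gain: while [U] has at least [2 * #|K|]
    vertices, [big_indep] with [L = 1] spends one colour on at least [q %/ 24] of them; a smaller
    [U] is coloured in pairs. *)
Lemma all_colourable_dense q j : 0 < q -> all_colourable (q + j) (j * (q %/ 24)).
Proof.
move=> q0; elim: j => [|j IHj] K U kK Um.
  by case: q q0 kK Um => // q _ kK Um; apply: (all_colourable_trivial (k := q)); lia.
have K0 : 0 < #|K| by apply: leq_trans kK; rewrite addn_gt0 q0.
have [lt|le] := ltnP #|U| (2 * #|K|).
  by apply: (all_colourable_pairs (k := #|K|.-1)); rewrite ?prednK //; lia.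
have [|i [W [iK WU WI Wc]]] := @big_indep K U 1 K0; first by lia.
apply: (colourable_step iK WI); apply: IHj; first by apply: leq_cardsD1; rewrite -addnS.
have : q %/ 24 <= #|W|.
  by rewrite -(leq_pmul2l (ltn0Sn 23)) (leq_trans _ Wc) // mul1n mulnC (leq_trans (leq_divM _ _)) //; lia.
rewrite cardsD (setIidPr WU); lia.
Qed.

(** The main phase: while more than [B] vertices are left, [U] is so large compared with [r] that
    each colour disposes of at least [L * q %/ 24] vertices. The last [B] vertices are left to [q]
    colours. *)
Lemma all_colourable_sparse q B L j : 0 < q -> 4 ^ L * r <= 2 * B ->
  all_colourable q B -> all_colourable (q + j) (B + j * (L * q %/ 24)).
Proof.
move=> q0 LB HB; elim: j => [|j IHj] K U kK Um; first by apply: HB; lia.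
have K0 : 0 < #|K| by apply: leq_trans kK; rewrite addn_gt0 q0.
have [le|lt] := leqP #|U| B; first by apply: HB => //; lia.
have Kr : #|K| <= r by have := max_card (mem K); rewrite card_ord.
have [|i [W [iK WU WI Wc]]] := @big_indep K U L K0.
  apply: (@leq_trans (4 ^ L * r)); first by rewrite leq_mul2l Kr orbT.
  by apply: leq_trans LB _; rewrite leq_mul2l ltnW // orbT.
apply: (colourable_step iK WI); apply: IHj; first by apply: leq_cardsD1; rewrite -addnS.
have : L * q %/ 24 <= #|W|.
  rewrite -(leq_pmul2l (ltn0Sn 23)) (leq_trans _ Wc) // mulnC (leq_trans (leq_divM _ _)) //.
  by rewrite leq_mul2l; apply/orP; right; lia.
rewrite cardsD (setIidPr WU); lia.
Qed.
End Greedy.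

Lemma minimal_degree_gt r (V : finType) (E : rel V) (v : V) m : 0 < r -> ramsey_minimal_K3 r E ->
  (forall (F : rel V) (c : V -> V -> 'I_r), symmetric F -> irreflexive F -> good_col F c ->
     all_colourable F c r m) -> m < degree E v.
Proof.
move=> r0 minE col; have [c cG blk] := minimal_blocking v r0 minE.
have [[ES EI] _] := minE.
rewrite ltnNge; apply/negP => le.
have [|||f _ fc] := col _ _ _ _ cG [set: 'I_r] [set u | E v u] _ le.
- by move=> x y; rewrite ES; congr andb; apply: andbC.
- by move=> x; rewrite EI.
- by rewrite cardsT card_ord.
have [x [y [vx vy xy e1 e2]]] := blk f.
apply: (fc x y) e2; rewrite ?inE // xy /=.
by apply/andP; split; apply/eqP => e; rewrite e EI in vx vy.
Qed.

(** Of the [4 * q] colours, [2 * q] are reserved for the last [q * (q %/ 24)] vertices; each of the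
    other [2 * q] removes [L * (2 * q) %/ 24] vertices. *)
Lemma minimal_degree_lower r (V : finType) (E : rel V) (v : V) q L :
  0 < q -> 4 * q <= r -> 4 ^ L * r <= 2 * (q * (q %/ 24)) -> ramsey_minimal_K3 r E ->
  2 * q * (L * (2 * q) %/ 24) < degree E v.
Proof.
move=> q0 qr LB minE; have r0 : 0 < r by apply: leq_trans qr; rewrite muln_gt0.
apply: (minimal_degree_gt v r0 minE) => F c FS FI cG.
have D2 : all_colourable F c (2 * q) (q * (q %/ 24)).
  by rewrite mul2n -addnn; apply: all_colourable_dense.
have q2 : 0 < 2 * q by rewrite muln_gt0 q0.
have H := @all_colourable_sparse _ _ _ _ FS FI cG _ _ _ (2 * q) q2 LB D2.
move=> K U Kr Um; apply: H.
  by apply: leq_trans Kr; apply: leq_trans qr; lia.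
exact: leq_trans Um (leq_addl _ _).
Qed.

Lemma minimal_degree_pos r (V : finType) (E : rel V) (v : V) :
  0 < r -> ramsey_minimal_K3 r E -> 0 < degree E v.
Proof.
move=> r0 minE; apply: (minimal_degree_gt v r0 minE) => F c _ _ _.
by move=> K U Kr; apply: (@all_colourable_trivial _ _ F c r.-1); rewrite prednK.
Qed.

(** * The two bounds *)

Lemma s_r_K3_exists r n :
  (exists (V : finType) (E : rel V) (v : V), ramsey_minimal_K3 r E /\ degree E v <= n) ->
  exists s, [/\ is_s_r_K3 r s, s <= n &
    exists (V : finType) (E : rel V) (v : V), ramsey_minimal_K3 r E /\ degree E v = s].
Proof.
case=> V0 [E0 [v0 [min0 d0]]].
pose P (G : {V : finType & (rel V * V)%type}) := let: existT V (E, v) := G in ramsey_minimal_K3 r E.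
pose f (G : {V : finType & (rel V * V)%type}) := let: existT V (E, v) := G in degree E v.
have [|[V [E v]] /= minE minP] := @exists_min _ P f.
  by exists (existT (fun V : finType => (rel V * V)%type) V0 (E0, v0)).
have le (W : finType) (F : rel W) (w : W) : ramsey_minimal_K3 r F -> degree E v <= degree F w.
  exact: (minP (existT (fun V : finType => (rel V * V)%type) W (F, w))).
exists (degree E v); split; last by exists V, E, v.
- split; last by move=> W F /le; apply.
  by exists V, E; split=> //; split; [exists v|move=> w; apply: le].
- exact: leq_trans (le _ _ _ min0) d0.
Qed.

Lemma exists_small_degree D r l : 4 * 768 <= D -> D <= 2 ^ 13 -> 1 < r -> 0 < l -> r <= 2 ^ l ->
  exists (V : finType) (E : rel V) (v : V),
    ramsey_minimal_K3 r E /\ degree E v <= r * (D * (D * r * l ^ 2)).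
Proof.
move=> D1 D2 r1 l0 rl; have [F [c [sF cG blk]]] := star_blocking_exists D1 D2 (ltnW r1) l0 rl.
have [V [E [v [sE RE dv nR]]]] := ramsey_small_degree r1 sF cG blk.
by apply: minimal_small_degree sE RE _ nR; rewrite card_ord in dv.
Qed.

Section GreedyParameters.
Import ring.

(** Base 16 makes [4 ^ L] at most the square root of [r], so [4 ^ L * r] has smaller order than
    [q ^ 2]; [3 < L] makes [r] large enough for all roundings. In [300 = 25 * 12], the 25 comes from
    [r <= 5 * q] and the 12 from the rounded division by 24. *)
Lemma greedy_parameters r (L := trunc_log 16 r) (q := r %/ 4) : 3 < L ->
  [/\ 0 < q, 4 * q <= r, 4 ^ L * r <= 2 * (q * (q %/ 24)) &
     L * r ^ 2 <= 300 * (2 * q * (L * (2 * q) %/ 24))].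
Proof.
move=> L4; have r0 : 0 < r by rewrite lt0n; apply/eqP => e; rewrite /L e trunc_log0 in L4.
have ar : 4 ^ L * 4 ^ L <= r by rewrite -expnMn trunc_logP.
have a4 : 256 <= 4 ^ L by rewrite -[256]/(4 ^ 4) leq_exp2l.
move: (4 ^ L) ar a4 => a ar a4.
have q4 : 4 * q <= r by rewrite mulnC leq_divM.
have r4 : r <= 4 * q + 3 by rewrite /q; lia.
have ra : 256 * a <= r by apply: leq_trans ar; rewrite leq_mul2r a4 orbT.
have qa : 60 * a + 24 <= q by lia.
split=> //; first by lia.
  have h1 : 5 * a <= 2 * (q %/ 24) by lia.
  have h2 : r <= 5 * q by lia.
  rewrite mulnCA; apply: leq_trans (_ : q * (5 * a) <= _); last by rewrite leq_mul2l h1 orbT.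
  by rewrite (_ : q * (5 * a) = a * (5 * q)) ?leq_mul2l ?h2 ?orbT //; ring.
have h1 : 12 * (2 * q * (L * (2 * q) %/ 24)) >= L * q ^ 2.
  have h : L * q <= 12 * (2 * (L * (2 * q) %/ 24)).
    have q24 : 24 <= q by lia.
    have : 24 <= L * q by apply: leq_trans q24 _; rewrite leq_pmull // (leq_trans _ L4).
    by rewrite (mulnCA L 2 q); move: (L * q) => x x24; lia.
  rewrite -mulnn (_ : L * (q * q) = q * (L * q)); last by ring.
  rewrite (_ : 12 * (2 * q * _) = q * (12 * (2 * (L * (2 * q) %/ 24)))); last by ring.
  by rewrite leq_mul2l h orbT.
have h2 : r ^ 2 <= 25 * q ^ 2 by rewrite -[25]/(5 ^ 2) -expnMn leq_sqr; lia.
apply: (@leq_trans (25 * (L * q ^ 2))); first by rewrite mulnCA leq_mul2l h2 orbT.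
by rewrite -[300]/(25 * 12) -mulnA leq_mul2l h1.
Qed.
End GreedyParameters.

From Stdlib Require Import Reals Lra.
Open Scope R_scope.

Lemma INR_expn (m n : nat) : INR (expn m n) = INR m ^ n.
Proof. by elim: n => [|n IHn] //=; rewrite expnS mult_INR IHn. Qed.

Lemma ln2_lt1 : ln 2 < 1.
Proof.
rewrite -[X in _ < X]ln_exp; apply: ln_increasing; first lra.
by have := exp_ineq1 1 R1_neq_R0; lra.
Qed.

Lemma ln_le_log16 (r : nat) : (0 < r)%nat -> ln (INR r) <= 4 * INR (trunc_log 16 r).+1.
Proof.
move=> r0; have R0 : 0 < INR r by apply: lt_0_INR; apply/ltP.
have lt : INR r < INR 16 ^ (trunc_log 16 r).+1.
  by rewrite -INR_expn; apply: lt_INR; apply/ltP; apply: trunc_log_ltn.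
apply: Rle_trans (Rlt_le _ _ (ln_increasing _ _ R0 lt)) _.
have e16 : INR 16 = 2 ^ 4 by rewrite /=; lra.
have ln0 := pos_INR (trunc_log 16 r).+1.
rewrite e16 ln_pow; last lra.
rewrite ln_pow; last lra.
have -> : INR 4 = 4 by rewrite /=; lra.
by have := ln2_lt1; move: (INR _) ln0 => x; nra.
Qed.

Lemma up_log_le_ln (r : nat) : (1 < r)%nat -> INR (up_log 2 r) <= 4 * ln (INR r).
Proof.
move=> r1; have l2 : / 2 < ln 2 := ln_lt_2.
have r2 : 2 <= INR r by have := le_INR 2 r (leP r1); rewrite /=; lra.
have e1 : ln 2 <= ln (INR r) by case: r2 => [lt|<-]; [apply/Rlt_le/ln_increasing; lra|apply: Rle_refl].
have l0 : (0 < up_log 2 r)%nat by rewrite up_log_gt0.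
have lt : INR 2 ^ (up_log 2 r).-1 < INR r.
  by rewrite -INR_expn; apply: lt_INR; apply/ltP; apply: up_log_gtn.
have e2 : INR (up_log 2 r).-1 * ln 2 < ln (INR r).
  by rewrite -ln_pow; [apply: ln_increasing => //; apply: pow_lt|]; rewrite /=; lra.
have -> : INR (up_log 2 r) = INR (up_log 2 r).-1 + 1 by rewrite -S_INR prednK.
by have := pos_INR (up_log 2 r).-1; nra.
Qed.

Theorem theorem1 :
  exists c C : R, 0 < c /\ 0 < C /\
    forall r : nat, leq 2 r ->
      exists s : nat, is_s_r_K3 r s /\
        c * (INR r ^ 2) * ln (INR r) <= INR s /\
        INR s <= C * (INR r ^ 2) * (ln (INR r) ^ 2).
Proof.
have [D [D1 D2]] : exists D, (4 * 768 <= D)%nat /\ (D <= 2 ^ 13)%nat.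
  by exists (4 * 768)%nat; split.
have D0 : 0 < INR D by apply: lt_0_INR; apply/ltP; apply: leq_trans D1.
(* [16 ^ 9 = (16 ^ 4) ^ 2 * (4 * 4)] bounds [r ^ 2 * ln r] for [r] up to [16 ^ 4]. The factor 16 in
   the other constant is the square of the 4 in [up_log_le_ln]. *)
exists (/ 16 ^ 9), (16 * INR D ^ 2); split; first by apply: Rinv_0_lt_compat; apply: pow_lt; lra.
split; first by have := pow_lt _ 2 D0; lra.
move=> r r1; have r0 := ltnW r1.
have l0 : (0 < up_log 2 r)%nat by rewrite up_log_gt0.
have [s [sP sle [V [E [v [minE dv]]]]]] :=
  s_r_K3_exists (exists_small_degree D1 D2 r1 l0 (@up_logP 2 r isT)).
exists s; split=> //; split.
- have r2 : 2 <= INR r by have := le_INR 2 r (leP r1); rewrite /=; lra.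
  have ln_r := ln_le_log16 r0.
  have p16 : 0 < 16 ^ 9 by apply: pow_lt; lra.
  have sq : 0 <= INR r ^ 2 by apply: pow_le; lra.
  apply: (Rmult_le_reg_l (16 ^ 9)) => //.
  have -> : 16 ^ 9 * (/ 16 ^ 9 * INR r ^ 2 * ln (INR r)) = INR r ^ 2 * ln (INR r).
    by field; apply: Rgt_not_eq.
  apply: Rle_trans (Rmult_le_compat_l _ _ _ sq ln_r) _.
  (* For [r] below [16 ^ 4] the positivity of the minimum degree suffices; otherwise the greedy
     bound applies. *)
  have [L3|L4] := leqP (trunc_log 16 r) 3.
    have s1 : 1 <= INR s.
      have := le_INR 1 s; rewrite /=; apply; apply/leP; rewrite -dv.
      exact: minimal_degree_pos r0 minE.
    have L4 : INR (trunc_log 16 r).+1 <= 4.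
      by have := le_INR (trunc_log 16 r).+1 4; rewrite [INR 4]/=; move=> H; have := H (le_n_S _ _ (leP L3)); lra.
    have rR : INR r <= 16 ^ 4.
      have e16 : INR 16 = 16 by rewrite /=; lra.
      rewrite -e16 -INR_expn; apply/le_INR/leP; apply: ltnW.
      apply: leq_trans (trunc_log_ltn r (isT : (1 < 16)%nat)) _.
      by rewrite leq_exp2l.
    have rR2 : INR r ^ 2 <= (16 ^ 4) ^ 2 by apply: pow_incr; lra.
    have L0 := pos_INR (trunc_log 16 r).+1.
    apply: Rle_trans (_ : (16 ^ 4) ^ 2 * (4 * 4) <= _).
      by apply: Rmult_le_compat => //; lra.
    have -> : (16 ^ 4) ^ 2 * (4 * 4) = 16 ^ 9 * 1 by ring.
    by apply: Rmult_le_compat_l; lra.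
  have [q0 qr LB h] := greedy_parameters L4.
  have lt := minimal_degree_lower v q0 qr LB minE.
  have := leq_trans h (leq_mul (leqnn 300) (ltnW lt)); rewrite dv.
  move/leP/le_INR; rewrite mult_INR INR_expn mult_INR [INR 300]INR_IZR_INZ [Z.of_nat _]/= => H.
  have L1 : 1 <= INR (trunc_log 16 r).
    by have := le_INR 1 (trunc_log 16 r); rewrite /=; apply; apply/leP; apply: leq_trans L4.
  rewrite S_INR; have s0 := pos_INR s.
  (* [2400 = 300 * 8], since [4 * (L + 1) <= 8 * L] for the base 16 logarithm [L >= 1]. *)
  apply: Rle_trans (_ : 2400 * INR s <= _); last by apply: Rmult_le_compat_r => //; lra.
  have : INR r ^ 2 <= INR (trunc_log 16 r) * INR r ^ 2 by nra.
  by move: (INR r ^ 2) (INR _) H => x y; nra.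
- have := le_INR _ _ (leP sle); rewrite !mult_INR => H.
  have U : INR (up_log 2 r) ^ 2 <= (4 * ln (INR r)) ^ 2.
    by apply: pow_incr; split; [apply: pos_INR|apply: up_log_le_ln].
  apply: Rle_trans H _.
  have -> : INR r * (INR D * (INR D * INR r * (INR (up_log 2 r) * INR (up_log 2 r)))) =
    (INR r * INR D) ^ 2 * INR (up_log 2 r) ^ 2 by ring.
  have -> : 16 * INR D ^ 2 * INR r ^ 2 * ln (INR r) ^ 2 =
    (INR r * INR D) ^ 2 * (4 * ln (INR r)) ^ 2 by ring.
  by apply: Rmult_le_compat_l U; apply: pow2_ge_0.
Qed.
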